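(* Let $\lambda/\mu$ be a skew shape with $n\ge 2$ cells such that $\lambda/\mu$ or its reverse $(\lambda/\mu)^{\mathrm{rev}}$ is one of the following near-hooks: (a) (hook minus its corner cell) $(1^k)\oplus(n-k)$, with $1\le k\le n-1$; (b) (hook plus a disconnected cell) $(n-k,1^{k-1})\oplus(1)$ or $(1)\oplus(n-k,1^{k-1})$, with $1\le k\le n-1$; (c) (hook plus an internal cell) $(n-k,2,1^{k-2})$, with $2\le k\le n-2$. Let $T\in\mathrm{SYT}(\lambda/\mu)$. Then: 1. There exists a unique cyclic descent map $\mathrm{cDes}$ for $\lambda/\mu$, specified by letting $$n\in\mathrm{cDes}(T)\iff |\mathrm{Des}(T)|=k-1 .$$ In particular, $|\mathrm{cDes}(T)|=k$. 2. Explicitly, the condition for $n\in\mathrm{cDes}(T)$ is given in each case as follows. In case (a), let $C$ be the set of entries of $T$ in the column $(1^k)$. In cases (b) and (c), let $C$ be the set of entries of $T$ in the column $(1^{k-1})$ of the hook, excluding the corner cell of the hook. In case (b), let $T_0$ be the entry in the disconnected cell. In case (c), let $T_{\mathrm{int}}$ be the entry in the internal cell. - $\lambda/\mu=(1^k)\oplus(n-k)$: $n\in\mathrm{cDes}(T)$ iff $1\in C$. - $\lambda/\mu=((1^k)\oplus(n-k))^{\mathrm{rev}}$: iff $n\in C$. - $\lambda/\mu=(n-k,1^{k-1})\oplus(1)$: iff $T_0\in(C-1)\sqcup\{n\}$. - $\lambda/\mu=((n-k,1^{k-1})\oplus(1))^{\mathrm{rev}}$: iff $T_0\in(C+1)\sqcup\{1\}$.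 - $\lambda/\mu=(1)\oplus(n-k,1^{k-1})$: iff $T_0\in(C-1)\sqcup\{1\}$. - $\lambda/\mu=((1)\oplus(n-k,1^{k-1}))^{\mathrm{rev}}$: iff $T_0\in(C+1)\sqcup\{n\}$. - $\lambda/\mu=(n-k,2,1^{k-2})$: iff $T_{\mathrm{int}}\in C+1$. - $\lambda/\mu=(n-k,2,1^{k-2})^{\mathrm{rev}}$: iff $T_{\mathrm{int}}\in C-1$.
   Context: Let $[n]=\{1,\dots,n\}$ and let $2^{[n]}$ be the set of subsets of $[n]$. Tableaux are drawn in English notation (row 1 on top). For a skew shape $\lambda/\mu$ with $n$ cells, $\mathrm{SYT}(\lambda/\mu)$ is the set of standard Young tableaux of that shape; $\mathrm{Des}(T)=\{i\in[n-1]: i+1\text{ is in a lower row than } i\text{ in }T\}$. We write $s_1\oplus\cdots\oplus s_t$ for the skew shape with connected components $s_1,\dots,s_t$ ordered from southwest to northeast (distinct components share no row or column, and their exact distance is irrelevant). The reverse $(\lambda/\mu)^{\mathrm{rev}}$ is the skew shape obtained by rotating $\lambda/\mu$ by $180^\circ$. A partition such as $(n-k,1^{k-1})$ denotes its straight shape, and $(1^k)$, $(n-k)$ are a single column and a single row. For $\lambda/\mu=(n-k,2,1^{k-2})$ the internal cell is the cell in row 2, column 2; the corner cell of a hook $(a,1^b)$ is its upper-left cell. For a reversed shape, the disconnected cell, corner cell, internal cell and column are the images under the $180^\circ$ rotation (so the corner cell of a reversed hook is its lower-right cell). For a set $C$ of integers, $C\pm1=\{c\pm1:c\in C\}$ (no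 reduction modulo $n$). A cyclic descent map for $\lambda/\mu$ is a map $\mathrm{cDes}:\mathrm{SYT}(\lambda/\mu)\to 2^{[n]}$ such that (i) $\mathrm{cDes}(T)\cap[n-1]=\mathrm{Des}(T)$ for every $T\in\mathrm{SYT}(\lambda/\mu)$; and (ii) the multiset $\{\!\{\mathrm{cDes}(T):T\in\mathrm{SYT}(\lambda/\mu)\}\!\}$ is closed under cyclic rotation modulo $n$, i.e. invariant under adding $1$ modulo $n$ to all elements of each set.
   Formalization: For n=2 (shape (1)⊕(1)) uniqueness of cDes fails as stated, since both ({2},{1}) and (∅,{1,2}) are cyclic descent maps; there uniqueness is claimed only among maps whose values are neither ∅ nor [n]. *)

(* Defs.v *)
From HB Require Import structures.
From mathcomp Require Import all_boot all_order all_algebra.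
Set Implicit Arguments.
Unset Strict Implicit.
Unset Printing Implicit Defensive.

(* Cells are (row, column), 0-based, rows numbered downwards.  Integer rather
   than natural coordinates make translation and rotation total and exact. *)
Notation cell := (int * int)%type.

Definition row_of (c : cell) : int := c.1.
Definition col_of (c : cell) : int := c.2.

Definition is_partition (la : seq nat) : bool := sorted geq la && (0 \notin la).

Definition is_skew_shape (lam mu : seq nat) : Prop :=
  [/\ is_partition lam, is_partition mu
    & forall i, nth 0 mu i <= nth 0 lam i].

Definition skew_cells (lam mu : seq nat) : seq cell :=
  [seq (Posz i, Posz j) | i <- iota 0 (size lam),
                          j <- iota (nth 0 mu i) (nth 0 lam i - nth 0 mu i)].

Definition shift (p c : cell) : cell := ((p.1 + c.1)%R, (p.2 + c.2)%R).

(* Rotation by 180 degrees about the origin.  All shapes below are described up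
   to translation, so the choice of centre is irrelevant. *)
Definition rot180 (c : cell) : cell := ((- c.1)%R, (- c.2)%R).

(* Straight shape [la] with its upper-left cell placed at [p]. *)
Definition diagram (p : cell) (la : seq nat) : seq cell :=
  map (shift p) (skew_cells la [::]).

(* Letters: the element [i] of ['I_n] stands for the letter [i.+1] of
   the alphabet 1, ..., n.  [letters] and [entry] give the letters themselves. *)
Definition letters (n : nat) (A : {set 'I_n}) : seq nat := [seq (val i).+1 | i in A].

Notation shape_cell_of lam mu := (seq_sub (skew_cells lam mu)).

Section Tableaux.
Variables (n : nat) (lam mu : seq nat).
Local Notation shape_cell := (shape_cell_of lam mu).

Definition is_syt (T : {ffun shape_cell -> 'I_n}) : bool :=
  [&& injectiveb T, [forall i, i \in codom T]
    & [forall c : shape_cell, forall d : shape_cell,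
        ((row_of (val c) == row_of (val d)) && (col_of (val c) < col_of (val d))%R
           ==> (T c < T d)) &&
        ((col_of (val c) == col_of (val d)) && (row_of (val c) < row_of (val d))%R
           ==> (T c < T d))]].

Record SYT := MkSYT { filling :> {ffun shape_cell -> 'I_n}; _ : is_syt filling }.
HB.instance Definition _ := [isSub for filling].
HB.instance Definition _ := [Finite of SYT by <:].

Definition entry (T : SYT) (c : shape_cell) : nat := (T c).+1.

Definition entries (T : SYT) (P : seq cell) : seq nat :=
  [seq entry T c | c <- enum {: shape_cell} & val c \in P].

Definition Des (T : SYT) : {set 'I_n} :=
  [set i | [exists c : shape_cell, exists d : shape_cell,
     [&& T c == i, val (T d) == i.+1 & (row_of (val c) < row_of (val d))%R]]].

(* [ordS] is addition of 1 modulo [n]; [i.+1 < n] says that the letter [i.+1]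
   is at most [n - 1]; equality of multisets is [perm_eq]. *)
Definition is_cyclic_descent_map (cDes : SYT -> {set 'I_n}) : Prop :=
  (forall T, cDes T :&: [set i : 'I_n | i.+1 < n] = Des T) /\
  perm_eq [seq [set ordS i | i in cDes T] | T : SYT] [seq cDes T | T : SYT].

End Tableaux.

(* [D] is the direct sum of [D1] (southwest) and [D2] (northeast), at any
   distance. *)
Definition is_oplus (D D1 D2 : seq cell) : Prop :=
  D =i D1 ++ D2 /\
  forall c d, c \in D1 -> d \in D2 ->
    (row_of d < row_of c)%R /\ (col_of c < col_of d)%R.

Definition hook (n k : nat) : seq nat := (n - k) :: nseq (k - 1) 1.

(* The column (1^(k-1)) of a hook with corner at [p], without the corner. *)
Definition hook_column (p : cell) (k : nat) : seq cell :=
  diagram (shift p (1%R, 0%R)) (nseq (k - 1) 1).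

(* In the next four predicates [D] is the set of cells of the shape, [C] the
   list of cells of the distinguished column, and [c0] the disconnected, resp.
   internal, cell. *)

(* (1^k) (+) (n-k) *)
Definition hook_minus_corner (n k : nat) (D C : seq cell) : Prop :=
  1 <= k <= n - 1 /\
  exists p q : cell,
    C = diagram p (nseq k 1) /\ is_oplus D C (diagram q [:: n - k]).

(* (n-k,1^(k-1)) (+) (1) *)
Definition hook_plus_NE_cell (n k : nat) (D C : seq cell) (c0 : cell) : Prop :=
  1 <= k <= n - 1 /\
  exists p : cell,
    C = hook_column p k /\ is_oplus D (diagram p (hook n k)) [:: c0].

(* (1) (+) (n-k,1^(k-1)) *)
Definition hook_plus_SW_cell (n k : nat) (D C : seq cell) (c0 : cell) : Prop :=
  1 <= k <= n - 1 /\
  exists p : cell,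
    C = hook_column p k /\ is_oplus D [:: c0] (diagram p (hook n k)).

(* (n-k,2,1^(k-2)) *)
Definition hook_plus_internal_cell (n k : nat) (D C : seq cell) (c0 : cell) : Prop :=
  2 <= k <= n - 2 /\
  exists p : cell,
    [/\ C = hook_column p k, c0 = shift p (1%R, 1%R)
      & D =i diagram p [:: n - k, 2 & nseq (k - 2) 1]].

Definition near_hook (n k : nat) (D : seq cell) : Prop :=
  [\/ exists C, hook_minus_corner n k D C,
      exists C c0, hook_plus_NE_cell n k D C c0 \/ hook_plus_SW_cell n k D C c0
    | exists C c0, hook_plus_internal_cell n k D C c0].

(* The eight explicit criteria.  For a reversed shape, the rotated shape is a
   near-hook, and [C], [c0] are those cells of the original shape that rotate to
   the distinguished cells of that near-hook.  The sets C - 1 and C + 1 are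
   [map predn] and [map succn] of the entries of [C]; as all entries are
   positive, the truncation of [predn] at 0 plays no role. *)
Definition explicit_criteria (n k : nat) (lam mu : seq nat)
    (cDes : SYT n lam mu -> {set 'I_n}) (T : SYT n lam mu) : Prop :=
  let D := skew_cells lam mu in
  let Drev := map rot180 D in
  let n_in_cDes : Prop := n \in letters (cDes T) in
  [/\ (forall C, hook_minus_corner n k D C ->
         n_in_cDes <-> 1 \in entries T C)
   /\ (forall C, hook_minus_corner n k Drev (map rot180 C) ->
         n_in_cDes <-> n \in entries T C),
      (forall C (c0 : shape_cell_of lam mu),
         hook_plus_NE_cell n k D C (val c0) ->
         n_in_cDes <-> (entry T c0 \in map predn (entries T C)) || (entry T c0 == n))
   /\ (forall C (c0 : shape_cell_of lam mu),
         hook_plus_NE_cell n k Drev (map rot180 C) (rot180 (val c0)) ->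
         n_in_cDes <-> (entry T c0 \in map succn (entries T C)) || (entry T c0 == 1)),
      (forall C (c0 : shape_cell_of lam mu),
         hook_plus_SW_cell n k D C (val c0) ->
         n_in_cDes <-> (entry T c0 \in map predn (entries T C)) || (entry T c0 == 1))
   /\ (forall C (c0 : shape_cell_of lam mu),
         hook_plus_SW_cell n k Drev (map rot180 C) (rot180 (val c0)) ->
         n_in_cDes <-> (entry T c0 \in map succn (entries T C)) || (entry T c0 == n))
    & (forall C (c0 : shape_cell_of lam mu),
         hook_plus_internal_cell n k D C (val c0) ->
         n_in_cDes <-> entry T c0 \in map succn (entries T C))
   /\ (forall C (c0 : shape_cell_of lam mu),
         hook_plus_internal_cell n k Drev (map rot180 C) (rot180 (val c0)) ->
         n_in_cDes <-> entry T c0 \in map predn (entries T C))].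

(* Main.v *)
Require Import Defs.
From mathcomp Require Import all_boot all_order all_algebra zify.
Set Implicit Arguments.
Unset Strict Implicit.
Unset Printing Implicit Defensive.

(** A standard tableau of a near-hook that is not reversed is recorded by the set
    [C] of the entries of its distinguished column and, if there is an extra cell,
    by the entry [z] of that cell. Unless the extra cell lies to the southwest,
    every entry [c > 1] of [C] makes [c - 1] a descent, and an extra cell contributes
    one more descent, which may fall outside the range from [1] to [n - 1] or be
    lost against [C]. So there are [k] or [k - 1] descents, the second case being
    the one of the explicit criterion, and adding [n] in that case gives a set of
    size [k].

    Rotation invariance holds because the number of tableaux with
    [cDes T = S], for a set [S] of size [k], is the same for all rotations of [S]:
    - in the hook minus its corner it is 1, since [cDes T] is [C - 1] modulo [n]
      ([minus_corner_family]);
    - in the hook with a disconnected cell to the northeast, [T] is determined by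
      [z], and [z] can be any element at which a cyclic run of [S] starts
      ([disconnected_family]);
    - in the hook with an internal cell, [T] is determined by [z], and [z - 1] can
      be any place where a run of [S] starts, or has just ended if [n] is in [S],
      except the first such place; so the number is that of the cyclic runs minus
      one ([internal_family], [card_inner_changes]).
    The hook with a disconnected cell to the southwest is the transpose of the one
    with a cell to the northeast, and transposition complements cyclic descent
    sets ([cyclic_familyC]). The reversed shapes follow because rotating a tableau
    by 180 degrees reflects cyclic descent sets ([cyclic_family_flip]).

    For uniqueness ([cyclic_family_unique]), a second cyclic descent map has values
    of size [k - 1], [k] or [k + 1]. A value of another size than [k] can be
    rotated to one whose trace on the letters below [n] is too small or too large
    to be a descent set, unless it is empty or full. Only one of these two
    exceptions is possible when [n > 2], and none when [n = 2] by assumption, so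
    the tableaux for which [n] is used form a subset, or a superset, of those of the
    first map. They are equally many, since [n] is used as often as [1], whose
    occurrences are dictated by the descents; hence both maps agree.

    The geometry is handled through the inverse of a tableau, which places the
    letters in cells ([placement]): such a placement is determined by the row or
    column of each letter ([placement_inj]), and filling chains of cells in
    increasing order produces placements ([placement_chains]). *)

(** The finite type of a cardinal may or may not be wrapped in a
    [reverse_coercion]; equal cardinals have to become one and the same atom. *)
Ltac card_lia := unfold reverse_coercion in *; simpl in *; lia.

(** * Cyclic rotation of sets of letters *)

Lemma val_ordS n (i : 'I_n.+1) : i != ord_max -> ordS i = i.+1 :> nat.
Proof.
rewrite -val_eqE /= => i_neq; have i_lt := ltn_ord i.
by rewrite modn_small // ltnS ltn_neqAle i_neq -ltnS.
Qed.

Lemma ordS_max n : ordS (ord_max : 'I_n.+1) = ord0.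
Proof. by apply: val_inj; rewrite /= modnn. Qed.

Lemma ord_pred0 n : ord_pred (ord0 : 'I_n.+1) = ord_max.
Proof. by rewrite -ordS_max ordSK. Qed.

Lemma ordS_eq0 n (i : 'I_n.+1) : (ordS i == ord0) = (i == ord_max).
Proof. by rewrite -(ordS_max n) (inj_eq (@ordS_inj _)). Qed.

Lemma ord_pred_eqmax n (i : 'I_n.+1) : (ord_pred i == ord_max) = (i == ord0).
Proof. by rewrite -ordS_eq0 ord_predK. Qed.

Lemma val_ord_pred n (i : 'I_n.+1) : i != ord0 -> ord_pred i = i.-1 :> nat.
Proof.
by rewrite -ord_pred_eqmax => /val_ordS; rewrite ord_predK => ->.
Qed.

Lemma ord_pred_neq n (i : 'I_n.+1) : 0 < n -> ord_pred i != i.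
Proof.
move=> n_gt0; have [->|i_neq0] := eqVneq i ord0.
  by rewrite ord_pred0 -val_eqE /=; lia.
apply/eqP => eq_i; have := val_ord_pred i_neq0; rewrite eq_i.
by move: i_neq0; rewrite -val_eqE /=; lia.
Qed.

Section Rotation.
Variable n : nat.
Implicit Types (i : 'I_n.+1) (S : {set 'I_n.+1}).

Definition cshift S : {set 'I_n.+1} := [set ordS i | i in S].

Lemma in_cshift S i : (i \in cshift S) = (ord_pred i \in S).
Proof.
apply/imsetP/idP => [[j jS ->]|]; first by rewrite ordSK.
by exists (ord_pred i); rewrite ?ord_predK.
Qed.

Lemma cshift_inj : injective cshift.
Proof. exact: imset_inj (@ordS_inj _). Qed.

Lemma card_cshift S : #|cshift S| = #|S|.
Proof. exact: card_imset (@ordS_inj _). Qed.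

Lemma cshiftC S : cshift (~: S) = ~: cshift S.
Proof. by apply/setP => i; rewrite !(inE, in_cshift). Qed.

Lemma iter_cshift S i m :
  (iter m (@ordS _) i \in iter m cshift S) = (i \in S).
Proof. by elim: m => //= m <-; rewrite in_cshift ordSK. Qed.

Lemma card_iter_cshift S m : #|iter m cshift S| = #|S|.
Proof. by elim: m => //= m <-; rewrite card_cshift. Qed.

Lemma iter_ordS_max i : iter (n - i) (@ordS _) i = ord_max.
Proof.
have [m] := ubnP (n - i); elim: m i => // m IH i lt_m.
have [->|neq] := eqVneq i ord_max; first by rewrite subnn.
have i_lt : i < n by move: neq (ltn_ord i); rewrite -val_eqE /=; lia.
rewrite -(prednK (n := n - i)) ?subn_gt0 // iterSr -subnS -(val_ordS neq).
by apply: IH; rewrite (val_ordS neq); lia.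
Qed.

(** A property of sets that is preserved by rotation can be tested on a
    rotation in which any prescribed element becomes the last letter. *)
Lemma rotate_to_max (P : {set 'I_n.+1} -> Prop) S i :
    (forall S', P S' -> P (cshift S')) -> P S ->
  exists S', [/\ P S', #|S'| = #|S| & (ord_max \in S') = (i \in S)].
Proof.
move=> Pshift PS; exists (iter (n - i) cshift S).
rewrite card_iter_cshift -{1}(iter_ordS_max i) iter_cshift; split=> //.
by elim: (n - i) => //= m; apply: Pshift.
Qed.

End Rotation.

(** * Abstract cyclic descent maps *)

Section CyclicFamilies.
Variable n : nat.
Local Notation letterset := {set 'I_n.+1}.
Implicit Types (A S : letterset) (k : nat).

(** The candidate for [cDes T], as a function of [A = Des T]: the last letter is
    added to the smaller of the two possible sizes [k - 1] and [k]. *)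
Definition cyc_close k A : letterset :=
  if #|A| == k.-1 then ord_max |: A else A.

Lemma max_in_cyc_close k A : ord_max \notin A ->
  (ord_max \in cyc_close k A) = (#|A| == k.-1).
Proof. by rewrite /cyc_close => /negPf A'max; case: ifP; rewrite ?setU11. Qed.

Lemma cyc_closeD1 k A : ord_max \notin A -> cyc_close k A :\ ord_max = A.
Proof.
move=> A'max; rewrite /cyc_close; case: ifP => _; first by rewrite setU1K.
by apply/setDidPl; rewrite disjoint_sym disjoints1.
Qed.

Section Distribution.
Variables (X : finType) (F : X -> letterset).

(** Rotation invariance of the multiset of values of [F], in terms of the
    multiplicities. *)
Definition shift_invariant : Prop :=
  forall S, #|[set x | F x == cshift S]| = #|[set x | F x == S]|.

Lemma card_by_value (P : pred letterset) :
  #|[set x | P (F x)]| = \sum_(S | P S) #|[set x | F x == S]|.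
Proof.
rewrite -sum1_card (partition_big F P) => [|x]; last by rewrite inE.
apply: eq_bigr => S PS; rewrite -sum1_card; apply: eq_bigl => x.
by rewrite !inE andbC; case: eqP => //= ->.
Qed.

Lemma card_shift_invariant (P : pred letterset) : shift_invariant ->
  #|[set x | P (F x)]| = #|[set x | P (cshift (F x))]|.
Proof.
move=> Finv; rewrite (card_by_value P) (card_by_value (P \o @cshift n)) /=.
have cshift_bij : bijective (@cshift n) := injF_bij (@cshift_inj n).
rewrite (reindex (@cshift n)); last exact: onW_bij.
by apply: eq_bigr => S _; rewrite Finv.
Qed.

End Distribution.

(** What a shape has to satisfy for [cyc_close k] to define its cyclic descent
    map. Only the descent sets occur, so that the transposed and the reversed
    shapes are covered by complementing and by reflecting these sets. *)
Definition cyclic_family k (X : finType) (des : X -> letterset) : Prop :=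
  [/\ forall x, ord_max \notin des x,
      forall x, #|cyc_close k (des x)| = k
    & shift_invariant (fun x => cyc_close k (des x))].

Lemma cyclic_family_card_des k (X : finType) (des : X -> letterset) x :
    0 < k -> cyclic_family k des ->
  k.-1 <= #|des x| <= k /\ (#|des x| == k.-1) = (#|des x| != k).
Proof.
move=> k_gt0 [/(_ x) des'max /(_ x) + _].
by rewrite /cyc_close; case: ifP; rewrite ?cardsU1 ?des'max; card_lia.
Qed.

Section Uniqueness.
Variables (k : nat) (X : finType) (des cd : X -> letterset).
Hypotheses (k_gt0 : 0 < k) (k_le : k <= n).
Hypothesis des_cyclic : cyclic_family k des.
Hypothesis cd_des : forall x, cd x :\ ord_max = des x.
Hypothesis cd_inv : shift_invariant cd.

Lemma card_cd x : #|cd x| = (ord_max \in cd x) + #|des x|.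
Proof. by rewrite (cardsD1 ord_max) cd_des. Qed.

Lemma rotated_value x i : exists y,
  #|cd y| = #|cd x| /\ (ord_max \in cd y) = (i \in cd x).
Proof.
pose P S := exists y, cd y = S.
have PS S : P S -> P (cshift S).
  case=> y cdy; have: 0 < #|[set z | cd z == cshift S]|.
    by rewrite cd_inv card_gt0; apply/set0Pn; exists y; rewrite inE cdy.
  by rewrite card_gt0 => /set0Pn[z]; rewrite inE => /eqP <-; exists z.
have [|_ [[y <-] card_y max_y]] := @rotate_to_max n P (cd x) i PS.
  by exists x.
by exists y.
Qed.

(** Rotating an element out of a value of size [k + 1], or into a value of
    size [k - 1], would give a descent set of impossible size. *)
Lemma cd_too_big x : k < #|cd x| -> cd x = setT.
Proof.
move=> big; apply/eqP; rewrite eqEsubset subsetT /=; apply/subsetP => i _.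
have [y [card_y max_y]] := rotated_value x i.
have := card_cd y; have := cyclic_family_card_des y k_gt0 des_cyclic.
by move: max_y; card_lia.
Qed.

Lemma cd_too_small x : #|cd x| < k -> cd x = set0.
Proof.
move=> small; apply/eqP; rewrite -subset0; apply/subsetP => i.
have [y [card_y <-]] := rotated_value x i.
by have := card_cd y; have := cyclic_family_card_des y k_gt0 des_cyclic; card_lia.
Qed.

(** By rotation the last letter occurs in the values of [F] as often as the
    first one, and the latter count is visible in [des]. *)
Lemma card_max_in (F : X -> letterset) :
  (forall x, F x :\ ord_max = des x) -> shift_invariant F ->
  #|[set x | ord_max \in F x]| = #|[set x | ord0 \in des x]|.
Proof.
move=> Fdes Finv.
rewrite -[LHS]/#|[set x | [pred S : letterset | ord_max \in S] (F x)]|.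
have neq0 : (ord0 : 'I_n.+1) != ord_max by rewrite -val_eqE /=; card_lia.
have ->: [set x | ord0 \in des x] = [set x | ord0 \in F x].
  by apply/setP=> x; rewrite !inE -Fdes !inE neq0.
rewrite -[RHS]/#|[set x | [pred S : letterset | ord0 \in S] (F x)]|.
rewrite [RHS](card_shift_invariant _ Finv); congr #|pred_of_set _|.
by apply/setP => x; rewrite !inE in_cshift ord_pred0.
Qed.

(** All shift-invariant lifts of [des] contain the last letter equally often,
    so it suffices to compare the two lifts by inclusion; only a value that is
    empty or full could spoil both inclusions, and then [n = 1]. *)
Lemma cyclic_family_unique :
  (n = 1 -> forall x, cd x != set0 /\ cd x != setT) ->
  forall x, cd x = cyc_close k (des x).
Proof.
move=> nontrivial; have [des'max _ close_inv] := des_cyclic.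
have eq_card : #|[set x | ord_max \in cd x]| = #|[set x | #|des x| == k.-1]|.
  rewrite (card_max_in cd_des cd_inv) -(card_max_in _ close_inv); last first.
    by move=> x; rewrite cyc_closeD1.
  by congr #|pred_of_set _|; apply/setP=> x; rewrite !inE max_in_cyc_close.
have small x : #|cd x| < k -> cd x = set0 /\ k = 1.
  move=> lt_k; have cd0 := cd_too_small lt_k; split=> //.
  have := card_cd x; have := cyclic_family_card_des x k_gt0 des_cyclic.
  by rewrite cd0 cards0 inE; card_lia.
have big x : k < #|cd x| -> cd x = setT /\ k = n.
  move=> lt_k; have cdT := cd_too_big lt_k; split=> //.
  have := card_cd x; have := cyclic_family_card_des x k_gt0 des_cyclic.
  by rewrite cdT cardsT card_ord inE; card_lia.
suff eq_max : [set x | ord_max \in cd x] = [set x | #|des x| == k.-1].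
  move=> x; have := congr1 (fun A : {set X} => x \in A) eq_max; rewrite !inE.
  rewrite /cyc_close -(cd_des x) => <-; case: ifP => [/setD1K-> //|max'].
  by apply/esym/setDidPl; rewrite disjoint_sym disjoints1 max'.
have [n1|n_neq1] := eqVneq n 1.
  apply/eqP; rewrite eqEcard eq_card leqnn andbT; apply/subsetP => x; rewrite !inE.
  have [_ notT] := nontrivial n1 x; have := @big x; have := card_cd x.
  have := cyclic_family_card_des x k_gt0 des_cyclic.
  case: (ltnP k #|cd x|) => [_ _ _ []//|]; first by move/eqP: notT.
  by card_lia.
have [kn|k_neqn] := eqVneq k n.
  apply/esym/eqP; rewrite eqEcard eq_card leqnn andbT; apply/subsetP => x; rewrite !inE.
  have := @small x; have := card_cd x; case: (ltnP #|cd x| k) => [_ _ []//|]; card_lia.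
apply/eqP; rewrite eqEcard eq_card leqnn andbT; apply/subsetP => x; rewrite !inE.
have := @big x; have := card_cd x; have := cyclic_family_card_des x k_gt0 des_cyclic.
by case: (ltnP k #|cd x|) => [_ _ _ []//|]; card_lia.
Qed.

End Uniqueness.

(** * Symmetries of cyclic families *)

(** Completing the ascents by the rule for [n.+1 - k] gives the complement of
    the completed descents: the last letter is a cyclic ascent exactly when it is
    not a cyclic descent. *)
Lemma cyc_closeC k A : k <= n -> ord_max \notin A -> #|cyc_close k A| = k ->
  cyc_close (n.+1 - k) (~: (ord_max |: A)) = ~: cyc_close k A.
Proof.
move=> k_le A'max; have := cardsC (ord_max |: A).
rewrite cardsU1 A'max card_ord /= => cardC.
rewrite /cyc_close; case: eqP => [eq_A|neq] card_A.
  by rewrite ifN //; move: card_A; rewrite cardsU1 A'max /=; card_lia.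
rewrite ifT; last by card_lia.
by apply/setP => i; rewrite !inE; case: eqP => //= ->.
Qed.

Lemma cyclic_familyC k (X : finType) (des : X -> letterset) : k <= n ->
  cyclic_family k des ->
  cyclic_family (n.+1 - k) (fun x => ~: (ord_max |: des x)).
Proof.
move=> k_le [des'max card_cyc inv].
have closeC x := cyc_closeC k_le (des'max x) (card_cyc x).
split=> [x|x|S]; first by rewrite !inE eqxx.
  rewrite closeC; have := cardsC (cyc_close k (des x)).
  by rewrite card_cyc card_ord; card_lia.
have eqC S' : [set x | cyc_close (n.+1 - k) (~: (ord_max |: des x)) == S']
      = [set x | cyc_close k (des x) == ~: S'].
  by apply/setP=> x; rewrite !inE closeC -(inj_eq (@setC_inj _)) setCK.
by rewrite !eqC -cshiftC inv.
Qed.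

(** Rotating a tableau with [N] letters by 180 degrees and complementing its entries
    turns a descent [l] into [N - l]. Here [N] is [n.+1] and [i] stands for the
    letter [i.+1], so that the reduction of [N - l] modulo [N] fixes [ord_max]. *)
Definition flip (i : 'I_n.+1) : 'I_n.+1 := ord_pred (rev_ord i).

Lemma rev_ord_max : rev_ord ord_max = ord0 :> 'I_n.+1.
Proof. by apply: val_inj; rewrite /= subnn. Qed.

Lemma rev_ordS (i : 'I_n.+1) : rev_ord (ordS i) = ord_pred (rev_ord i).
Proof.
have [->|i_neq] := eqVneq i ord_max.
  by rewrite ordS_max rev_ord_max ord_pred0 -rev_ord_max rev_ordK.
have rev_neq0 : rev_ord i != ord0 by rewrite -rev_ord_max (inj_eq rev_ord_inj).
apply: ord_inj; rewrite (val_ord_pred rev_neq0) -[LHS]/(n.+1 - (ordS i).+1).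
by rewrite (val_ordS i_neq) /= subnS.
Qed.

Lemma flip_max : flip ord_max = ord_max.
Proof. by rewrite /flip rev_ord_max ord_pred0. Qed.

Lemma flipS i : flip (ordS i) = ord_pred (flip i).
Proof. by rewrite /flip rev_ordS. Qed.

Lemma flipK : involutive flip.
Proof. by move=> i; rewrite {2}/flip -rev_ordS /flip rev_ordK ordSK. Qed.

Lemma cyclic_family_flip k (X : finType) (des : X -> letterset) :
  cyclic_family k des -> cyclic_family k (fun x => flip @^-1: des x).
Proof.
move=> [des'max card_cyc inv]; have flip_inj := inv_inj flipK.
have card_flip A : #|flip @^-1: A| = #|A|.
  by rewrite on_card_preimset //; apply/onW_bij/inv_bij/flipK.
have close_flip A : cyc_close k (flip @^-1: A) = flip @^-1: cyc_close k A.
  rewrite /cyc_close card_flip; case: ifP => // _.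
  by apply/setP=> i; rewrite !inE -{2}flip_max (inj_eq flip_inj).
have flip_preimK A : flip @^-1: (flip @^-1: A) = A.
  by apply/setP=> i; rewrite !inE flipK.
have eq_flip S : [set x | cyc_close k (flip @^-1: des x) == S]
      = [set x | cyc_close k (des x) == flip @^-1: S].
  apply/setP=> x; rewrite !inE close_flip.
  by apply/eqP/eqP => [<-|->]; rewrite flip_preimK.
split=> [x|x|S]; first by rewrite inE flip_max.
  by rewrite close_flip card_flip.
rewrite !eq_flip -inv; congr #|pred_of_set _|; apply/setP => x; rewrite !inE.
congr (_ == _); apply/setP => i.
by rewrite in_cshift !inE in_cshift -flipS ord_predK.
Qed.

End CyclicFamilies.

(** * Counting tableaux with a given cyclic descent set *)

Section Counting.
Variable n : nat.
Local Notation letterset := {set 'I_n.+1}.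
Implicit Types (A C S : letterset) (i u v y z : 'I_n.+1) (k : nat) (b : bool).

(** The letters at which a set starts ([b] is [false]) or has just ended ([b]
    is [true]), cyclically; there are equally many of both. *)
Definition changes b S : letterset :=
  [set i | ((i \in S) == ~~ b) && ((ord_pred i \in S) == b)].

Lemma card_changes b S : #|changes b S| = #|changes false S|.
Proof.
case: b => //; have startE : changes false S = S :\: cshift S.
  by apply/setP=> i; rewrite !inE in_cshift andbC; do 2!case: (_ \in S).
have endE : changes true S = cshift S :\: S.
  by apply/setP=> i; rewrite !inE in_cshift; do 2!case: (_ \in S).
by rewrite startE endE !cardsD card_cshift setIC.
Qed.

Lemma changes_cshift b S : changes b (cshift S) = cshift (changes b S).
Proof. by apply/setP=> i; rewrite !(inE, in_cshift). Qed.

Lemma card_changes_cshift b S : #|changes b (cshift S)| = #|changes b S|.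
Proof. by rewrite changes_cshift card_cshift. Qed.

(** For a set that is neither empty nor full, these are the changes of the kind
    that leads to the type (member or not) opposite to that of the last letter,
    except the first of them in the linear order. The omitted one moves under
    rotation, but the number of the others does not change. *)
Definition inner_changes S : letterset :=
  let b := ord_max \in S in
  [set i in changes b S | [exists u : 'I_n.+1, (u < i) && ((u \in S) == ~~ b)]].

Lemma card_inner_changes S : S != set0 -> S != setT ->
  #|inner_changes S| = #|changes false S|.-1.
Proof.
move=> S_neq0 S_neqT; set b := ord_max \in S.
have [u0 u0P] : exists u, (u \in S) == ~~ b.
  case: (b) => /=; last by have /set0Pn[u uS] := S_neq0; exists u; rewrite uS.
  move: S_neqT; rewrite -subTset => /subsetPn[u _ /negPf u'S].
  by exists u; rewrite u'S.
(* The first letter of the type opposite to the last letter is always a change,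
   since its cyclic predecessor is of the type of the last letter. *)
pose m := [arg min_(u < u0 | (u \in S) == ~~ b) val u].
have [mP m_min] : (m \in S) == ~~ b /\ forall u, (u \in S) == ~~ b -> m <= u.
  by rewrite /m; case: arg_minnP.
have m_change : m \in changes b S.
  rewrite inE mP /=; have [->|m_neq0] := eqVneq m ord0; first by rewrite ord_pred0 eqxx.
  have := m_min (ord_pred m); rewrite (val_ord_pred m_neq0).
  have: 0 < m by rewrite lt0n.
  by case: (_ \in S) (b) => [] [] //= m_gt0 /(_ isT); lia.
have ->: inner_changes S = changes b S :\ m.
  apply/setP=> i; rewrite in_setD1 [LHS]inE andbC -/b.
  case i_change: (i \in changes b S); rewrite ?andbF ?andbT //=.
  have iP : (i \in S) == ~~ b by move: i_change; rewrite inE => /andP[].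
  apply/existsP/idP => [[u /andP[u_lt /m_min m_le]]|i_neq].
    by rewrite -val_eqE /=; lia.
  exists m; rewrite mP andbT ltn_neqAle m_min // andbT.
  by rewrite eq_sym val_eqE.
by have := cardsD1 m (changes b S); rewrite m_change card_changes => ->.
Qed.

Lemma card_inner_changes_cshift S :
  #|inner_changes (cshift S)| = #|inner_changes S|.
Proof.
have [->|S_neq0] := eqVneq S set0; first by rewrite /cshift imset0.
have cshiftT : cshift [set: 'I_n.+1] = setT.
  by apply/setP=> i; rewrite in_cshift !inE.
have [->|S_neqT] := eqVneq S setT; first by rewrite cshiftT.
rewrite !card_inner_changes ?card_changes_cshift //.
  by rewrite -cards_eq0 card_cshift cards_eq0.
by rewrite -cshiftT (inj_eq (@cshift_inj n)).
Qed.

(** If the tableaux with cyclic descent set [S] are told apart by a letter that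
    ranges over [Y S], then the size of [Y S] is the multiplicity of [S]. *)
Lemma shift_invariant_fibers k (X : finType) (F : X -> letterset)
    (y : X -> 'I_n.+1) (Y : letterset -> letterset) :
  (forall x, #|F x| = k) ->
  (forall x x', F x = F x' -> y x = y x' -> x = x') ->
  (forall x, y x \in Y (F x)) ->
  (forall S i, #|S| = k -> i \in Y S -> exists x, F x = S /\ y x = i) ->
  (forall S, #|Y (cshift S)| = #|Y S|) ->
  shift_invariant F.
Proof.
move=> card_F inj_y y_in y_onto Y_inv S.
have [card_S|card_S] := eqVneq #|S| k; last first.
  rewrite !eq_card0 // => x; rewrite inE; apply: contra_neqF card_S => /eqP FxS.
    by rewrite -FxS card_F.
  by rewrite -card_cshift -FxS card_F.
have card_fiber S' : #|S'| = k -> #|[set x | F x == S']| = #|Y S'|.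
  move=> card_S'; rewrite -(card_in_imset (f := y)) => [|x x']; last first.
    by rewrite !inE => /eqP Fx /eqP Fx'; apply: inj_y; rewrite Fx Fx'.
  congr #|pred_of_set _|; apply/setP=> i; apply/imsetP/idP => [[x] |iY].
    by rewrite inE => /eqP <- ->.
  by have [x [Fx yx]] := y_onto _ _ card_S' iY; exists x; rewrite ?inE ?Fx.
by rewrite !card_fiber ?card_cshift.
Qed.

(** In a hook with an extra cell, [A] is the set of descents [c - 1] forced by the
    entries [c] of the leg, and [y] is a further descent due to the extra cell.
    Under the condition [q] that further descent is lost, and then the last letter
    takes its place in the cyclic descent set. *)
Definition close_pivot (q : bool) y A : letterset :=
  (if q then ord_max else y) |: A.

Section Pivot.
Variables (k : nat) (A : letterset) (q : bool) (y : 'I_n.+1).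
Hypotheses (k_gt0 : 0 < k) (A'max : ord_max \notin A) (card_A : #|A| = k.-1).
Hypothesis y_new : ~~ q -> y != ord_max /\ y \notin A.
Let des : letterset := if q then A else y |: A.

Lemma pivot_max : ord_max \notin des.
Proof.
rewrite /des; case: ifPn => // /y_new[y_neq _].
by rewrite in_setU1 eq_sym negb_or y_neq.
Qed.

Lemma pivot_card : (#|des| == k.-1) = q.
Proof.
rewrite /des; case: ifPn => [_|/y_new[_ A'y]]; first by rewrite card_A eqxx.
by rewrite cardsU1 A'y; card_lia.
Qed.

Lemma pivot_close : cyc_close k des = close_pivot q y A.
Proof. by rewrite /cyc_close pivot_card /des /close_pivot; case: q. Qed.

Lemma card_close_pivot : #|close_pivot q y A| = k.
Proof.
rewrite cardsU1; case: ifPn => [_|/y_new[_ /negPf->]]; rewrite ?A'max; card_lia.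
Qed.

Lemma max_in_close_pivot : (ord_max \in close_pivot q y A) = q.
Proof.
rewrite in_setU1 (negPf A'max) orbF; case: ifPn => [_|/y_new[]]; first exact: eqxx.
by rewrite eq_sym => /negPf.
Qed.

(** Hence two words with the same cyclic descent set and the same [y] have the same
    leg. *)
Lemma close_pivotK :
  let S := close_pivot q y A in
  A = S :\ (if ord_max \in S then ord_max else y).
Proof.
rewrite /= max_in_close_pivot setU1K //.
by case: ifPn => // /y_new[].
Qed.

End Pivot.

End Counting.

(** * Cyclic descents of the words of near-hooks *)

Section Words.
Variable n : nat.
Local Notation letterset := {set 'I_n.+1}.
Implicit Types (A C S : letterset) (i u v y z : 'I_n.+1) (k : nat).

Definition cunshift C : letterset := @ordS _ @^-1: C.

Lemma cunshiftK C : cshift (cunshift C) = C.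
Proof. by apply/setP=> i; rewrite in_cshift inE ord_predK. Qed.

Lemma cshiftK S : cunshift (cshift S) = S.
Proof. by apply/setP=> i; rewrite inE in_cshift ordSK. Qed.

Lemma card_cunshift C : #|cunshift C| = #|C|.
Proof. by rewrite -[in RHS](cunshiftK C) card_cshift. Qed.

Lemma max_in_cunshift C : (ord_max \in cunshift C) = (ord0 \in C).
Proof. by rewrite inE ordS_max. Qed.

(** In this shape [cDes T] is the whole set [C - 1], taken modulo [n], so that each
    [k]-subset is obtained exactly once. *)
Section MinusCorner.
Variables (k : nat) (X : finType) (des C : X -> letterset).
Hypotheses (k_gt0 : 0 < k) (card_C : forall x, #|C x| = k).
Hypothesis des_C : forall x, des x = cunshift (C x) :\ ord_max.

Lemma minus_corner_max x : (#|des x| == k.-1) = (ord0 \in C x).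
Proof.
have := cardsD1 ord_max (cunshift (C x)); rewrite -des_C card_cunshift card_C.
by rewrite max_in_cunshift; case: (_ \in _) => /=; card_lia.
Qed.

Lemma minus_corner_family :
  injective C -> (forall A, #|A| = k -> exists x, C x = A) ->
  cyclic_family k des.
Proof.
move=> C_inj C_onto.
have closeE x : cyc_close k (des x) = cunshift (C x).
  rewrite /cyc_close minus_corner_max des_C -max_in_cunshift.
  case: ifPn => [/setD1K //|max']; apply/setDidPl.
  by rewrite disjoint_sym disjoints1.
have card_cyc x : #|cyc_close k (des x)| = k by rewrite closeE card_cunshift.
split=> // [x|]; first by rewrite des_C setD11.
apply: (@shift_invariant_fibers _ k _ _ (fun=> ord0) (fun=> [set ord0])) => //.
- move=> x x'; rewrite !closeE => /(congr1 (@cshift n)).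
  by rewrite !cunshiftK => /C_inj.
- by move=> x; rewrite set11.
move=> S i card_S /set1P->; have [|x Cx] := C_onto (cshift S).
  by rewrite card_cshift.
by exists x; rewrite closeE Cx cshiftK.
Qed.

End MinusCorner.

(** The pairs formed by the leg entries [C] and the entry [z] of the disconnected
    cell, when that cell lies to the northeast. The last two conditions say that
    the smallest letter other than [z] is left for the corner. *)
Definition disconnected_word k C z : Prop :=
  [/\ z \notin C, #|C| = k.-1, ord0 \notin C
    & ~~ ((z == ord0) && (ordS ord0 \in C))].

Definition disconnected_lost C z := (z == ord_max) || (ordS z \in C).

Section Disconnected.
Variables (k : nat) (X : finType) (des leg : X -> letterset) (mark : X -> 'I_n.+1).
Hypothesis k_gt0 : 0 < k.
Hypothesis word_x : forall x, disconnected_word k (leg x) (mark x).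
Hypothesis des_word : forall x,
  des x = [set v | (v != ord_max) && ((ordS v \in leg x) || (v == mark x))].

Let pivot_new C z : ~~ disconnected_lost C z ->
  z != ord_max /\ z \notin cunshift C.
Proof. by rewrite negb_or inE => /andP. Qed.

Let max'C C z : disconnected_word k C z -> ord_max \notin cunshift C.
Proof. by case=> _ _ C'0 _; rewrite max_in_cunshift. Qed.

Let card_A C z : disconnected_word k C z -> #|cunshift C| = k.-1.
Proof. by case=> _ card_C _ _; rewrite card_cunshift. Qed.

Let desE x :
  des x = if disconnected_lost (leg x) (mark x) then cunshift (leg x)
          else mark x |: cunshift (leg x).
Proof.
have [_ _ /negPf C'0 _] := word_x x; rewrite des_word; apply/setP=> v.
case: ifPn => [lost|/pivot_new[z_neq _]]; rewrite !inE; last first.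
  have [->|_] := eqVneq v ord_max; last by rewrite orbC.
  by rewrite ordS_max C'0 eq_sym (negPf z_neq).
have [->|v_neq] := eqVneq v ord_max; first by rewrite ordS_max C'0.
have [vE|] := eqVneq v (mark x); last by rewrite orbF.
by move: lost; rewrite /disconnected_lost -vE (negPf v_neq) orbT => /= ->.
Qed.

Lemma disconnected_max x :
  (#|des x| == k.-1) = (mark x == ord_max) || (ordS (mark x) \in leg x).
Proof.
rewrite desE.
exact: pivot_card k_gt0 (max'C (word_x x)) (card_A (word_x x)) (@pivot_new _ _).
Qed.

Hypothesis n_gt0 : 0 < n.

(** Among the words with cyclic descent set [S], the marked letter takes each value
    at which a cyclic run of [S] starts, once. *)
Lemma disconnected_family :
  (forall x x', leg x = leg x' -> mark x = mark x' -> x = x') ->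
  (forall C z, disconnected_word k C z -> exists x, leg x = C /\ mark x = z) ->
  cyclic_family k des.
Proof.
move=> word_inj word_onto.
have closeE x : cyc_close k (des x)
    = close_pivot (disconnected_lost (leg x) (mark x)) (mark x) (cunshift (leg x)).
  rewrite desE.
  exact: pivot_close k_gt0 (max'C (word_x x)) (card_A (word_x x)) (@pivot_new _ _).
have card_close x : #|cyc_close k (des x)| = k.
  rewrite closeE.
  exact: card_close_pivot k_gt0 (max'C (word_x x)) (card_A (word_x x)) (@pivot_new _ _).
split=> // [x|].
  by rewrite desE; exact: pivot_max (max'C (word_x x)) (@pivot_new _ _).
apply: (shift_invariant_fibers (k := k) (y := mark) (Y := changes false)) => //.
- move=> x x' eq_close eq_mark; apply: (word_inj _ _ _ eq_mark).
  have legE t : cunshift (leg t) = cyc_close k (des t)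
      :\ (if ord_max \in cyc_close k (des t) then ord_max else mark t).
    rewrite closeE; exact: close_pivotK (max'C (word_x t)) (@pivot_new _ _).
  by rewrite -[LHS]cunshiftK -[RHS]cunshiftK !legE eq_close eq_mark.
- move=> x; have [C'z card_C C'0 z0] := word_x x.
  have C_pred : ord_pred (mark x) \in cunshift (leg x) = false.
    by rewrite inE ord_predK (negPf C'z).
  rewrite inE closeE !in_setU1 C_pred orbF; apply/andP; split.
    case: ifPn => [/orP[->//|lost]|]; last by rewrite eqxx.
    by rewrite inE lost orbT.
  case: ifPn => [lost|]; last by rewrite (negPf (ord_pred_neq _ n_gt0)).
  rewrite ord_pred_eqmax eqbF_neg; apply: contra z0 => z0; rewrite z0 /=.
  move: lost; rewrite /disconnected_lost (eqP z0) => /orP[|//].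
  by rewrite -val_eqE /=; lia.
- move=> S i card_S; rewrite inE => /andP[/eqP iS /eqP pred_iS].
  set y := if ord_max \in S then ord_max else i.
  have yS : y \in S by rewrite /y; case: ifP; rewrite ?iS.
  have AC : cunshift (cshift (S :\ y)) = S :\ y by rewrite cshiftK.
  have [|x [legx markx]] := word_onto (cshift (S :\ y)) i.
    split; rewrite ?(in_cshift, ordSK, ord_pred0, card_cshift, inE).
    + by rewrite pred_iS andbF.
    + by have := cardsD1 y S; rewrite yS card_S; card_lia.
    + by rewrite /y; case: ifP; rewrite ?eqxx ?andbF.
    + apply/negP => /and3P[/eqP i0 y_neq0 _]; move: pred_iS y_neq0.
      by rewrite /y i0 ord_pred0 => ->; rewrite eqxx.
  exists x; split=> //; rewrite closeE legx markx AC.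
  have ->: disconnected_lost (cshift (S :\ y)) i = (ord_max \in S).
    rewrite /disconnected_lost in_cshift ordSK !inE iS andbT /y.
    case: ifPn => [_|S'max]; first by rewrite orbN.
    by rewrite eqxx orbF; apply: contraNF S'max => /eqP <-; rewrite iS.
  by rewrite /close_pivot -/y setD1K.
exact: card_changes_cshift.
Qed.

End Disconnected.

(** The pairs formed by the leg entries [C] and the entry [z] of the internal cell.
    The letters [c] and [w] are witnesses that [z] exceeds its left neighbour and
    its upper neighbour, the latter being the least letter of the arm beyond the
    corner, where [0] stands. *)
Definition internal_word k C z : Prop :=
  [/\ z \notin C, #|C| = k.-1, ord0 \notin C,
      exists2 c, c \in C & c < z & exists2 w, w \notin C & 0 < w < z].

Section Internal.
Variables (k : nat) (X : finType) (des leg : X -> letterset) (mark : X -> 'I_n.+1).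
Hypothesis k_gt0 : 0 < k.
Hypothesis word_x : forall x, internal_word k (leg x) (mark x).
Hypothesis des_word : forall x,
  des x = [set v | (v != ord_max)
                   && ((ordS v \in leg x) || ((ordS v == mark x) && (v \notin leg x)))].

Let mark_neq0 C z : internal_word k C z -> z != ord0.
Proof. by case=> _ _ _ [c _]; rewrite -val_eqE /=; lia. Qed.

Let pivot_new C z : internal_word k C z -> ord_pred z \notin C ->
  ord_pred z != ord_max /\ ord_pred z \notin cunshift C.
Proof.
move=> Cz _; have [C'z _ _ _ _] := Cz.
by rewrite ord_pred_eqmax (mark_neq0 Cz) inE ord_predK.
Qed.

Let max'C C z : internal_word k C z -> ord_max \notin cunshift C.
Proof. by case=> _ _ C'0 _ _; rewrite max_in_cunshift. Qed.

Let card_A C z : internal_word k C z -> #|cunshift C| = k.-1.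
Proof. by case=> _ card_C _ _ _; rewrite card_cunshift. Qed.

Let desE x :
  des x = if ord_pred (mark x) \in leg x then cunshift (leg x)
          else ord_pred (mark x) |: cunshift (leg x).
Proof.
have [C'z _ /negPf C'0 _ _] := word_x x; rewrite des_word; apply/setP=> v.
have eqS : (ordS v == mark x) = (v == ord_pred (mark x)).
  by rewrite -[in RHS](inj_eq (@ordS_inj _)) ord_predK.
have pred_neq : ord_max == ord_pred (mark x) = false.
  by rewrite eq_sym ord_pred_eqmax (negPf (mark_neq0 (word_x x))).
rewrite inE eqS; have [->|v_neq] := eqVneq v ord_max.
  by case: ifP; rewrite !inE ordS_max C'0 ?pred_neq.
case: ifPn => [Cz|C'pred]; rewrite !inE; have [->|_] := eqVneq v (ord_pred _).
- by rewrite ord_predK Cz orbF.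
- by rewrite orbF.
- by rewrite C'pred orbT.
- by rewrite orbF.
Qed.

Lemma internal_max x : (#|des x| == k.-1) = (ord_pred (mark x) \in leg x).
Proof.
rewrite desE.
exact: pivot_card k_gt0 (max'C (word_x x)) (card_A (word_x x)) (pivot_new (word_x x)).
Qed.

Hypothesis n_gt0 : 0 < n.

(** Among the words with cyclic descent set [S], the predecessor of the marked
    letter takes each value in [inner_changes S] once: it is a change of [S], and
    the two inequalities bearing on the marked letter exclude the first change. *)
Lemma internal_family :
  (forall x x', leg x = leg x' -> mark x = mark x' -> x = x') ->
  (forall C z, internal_word k C z -> exists x, leg x = C /\ mark x = z) ->
  cyclic_family k des.
Proof.
move=> word_inj word_onto.
have closeE x : cyc_close k (des x)
    = close_pivot (ord_pred (mark x) \in leg x) (ord_pred (mark x)) (cunshift (leg x)).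
  rewrite desE.
  exact: pivot_close k_gt0 (max'C (word_x x)) (card_A (word_x x))
    (pivot_new (word_x x)).
have card_close x : #|cyc_close k (des x)| = k.
  rewrite closeE.
  exact: card_close_pivot k_gt0 (max'C (word_x x)) (card_A (word_x x))
    (pivot_new (word_x x)).
split=> // [x|].
  by rewrite desE; exact: pivot_max (max'C (word_x x)) (pivot_new (word_x x)).
apply: (@shift_invariant_fibers _ k _ _
          (@ord_pred _ \o mark) (@inner_changes n)) => //=.
- move=> x x' eq_close /ord_pred_inj eq_mark; apply: (word_inj _ _ _ eq_mark).
  have legE t : cunshift (leg t) = cyc_close k (des t)
      :\ (if ord_max \in cyc_close k (des t) then ord_max else ord_pred (mark t)).
    rewrite closeE; exact: close_pivotK (max'C (word_x t)) (pivot_new (word_x t)).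
  by rewrite -[LHS]cunshiftK -[RHS]cunshiftK !legE eq_close eq_mark.
- move=> x; have [/negPf C'z card_C C'0 [c Cc c_lt] [w C'w w_lt]] := word_x x.
  have z_neq0 := mark_neq0 (word_x x); set y := ord_pred (mark x).
  have y_val : y = (mark x).-1 :> nat := val_ord_pred z_neq0.
  have A'y : y \in cunshift (leg x) = false by rewrite inE ord_predK.
  have A_pred v : (ord_pred v \in cunshift (leg x)) = (v \in leg x).
    by rewrite inE ord_predK.
  rewrite inE closeE.
  rewrite (max_in_close_pivot (max'C (word_x x)) (pivot_new (word_x x))) -/y.
  apply/andP; split.
    rewrite inE !in_setU1 A'y A_pred orbF; case: ifPn => [Cy|C'y].
      by rewrite orbT ord_pred_eqmax (negPf z_neq0).
    by rewrite eqxx (negPf (ord_pred_neq _ n_gt0)).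
  have [Cy|C'y] := boolP (y \in leg x).
    have w_neq0 : w != ord0 by rewrite -val_eqE /=; lia.
    apply/existsP; exists (ord_pred w); rewrite in_setU1 A_pred (negPf C'w) orbF.
    rewrite ord_pred_eqmax (negPf w_neq0) val_ord_pred // y_val; lia.
  have c_neq0 : c != ord0 by apply: contraNneq C'0 => <-.
  apply/existsP; exists (ord_pred c); rewrite in_setU1 A_pred Cc orbT andbT.
  by rewrite val_ord_pred // y_val; move: c_neq0; rewrite -val_eqE /=; lia.
- move=> S i card_S; rewrite inE; set b := ord_max \in S.
  rewrite inE => /andP[/andP[/eqP iS /eqP pred_iS] /existsP[u /andP[u_lt /eqP uS]]].
  (* A letter of the type of [ord_max] cannot be a change of this kind. *)
  have i_neq : i != ord_max.
    by apply/eqP => i_max; move: iS; rewrite i_max -/b; case: (b).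
  have Si_val := val_ordS i_neq; pose y := if b then ord_max else i.
  have i_neq0 : i != ord0 by rewrite -val_eqE /=; lia.
  have yS : y \in S by rewrite /y /b; case: ifP; rewrite ?iS // /b => ->.
  have u_neq : u != ord_max by rewrite -val_eqE /=; have := ltn_ord i; lia.
  have Su_val := val_ordS u_neq.
  have CE v : (v \in cshift (S :\ y)) = (ord_pred v != y) && (ord_pred v \in S).
    by rewrite in_cshift !inE.
  have [|x [legx markx]] := word_onto (cshift (S :\ y)) (ordS i).
    split; rewrite ?(CE, ordSK, ord_pred0, card_cshift).
    + by rewrite iS /y; case: ifP; rewrite ?eqxx ?andbF.
    + by have := cardsD1 y S; rewrite yS card_S; card_lia.
    + by rewrite -/b /y; case: ifP; rewrite ?eqxx ?andbF.
    + case b_val: b; [exists i|exists (ordS u)]; rewrite ?CE ?ordSK ?uS ?pred_iS ?b_val.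
      * by rewrite /y b_val ord_pred_eqmax i_neq0.
      * by rewrite Si_val.
      * by rewrite /y b_val andbT -val_eqE /=; lia.
      * by rewrite Si_val Su_val.
    case b_val: b; [exists (ordS u)|exists i];
      rewrite ?CE ?ordSK ?uS ?pred_iS ?b_val ?andbF //.
    * by rewrite Si_val Su_val; lia.
    * by rewrite Si_val; move: i_neq0; rewrite -val_eqE /=; lia.
  exists x; split; last by rewrite markx ordSK.
  rewrite closeE legx markx ordSK cshiftK.
  have ->: (i \in cshift (S :\ y)) = b.
    rewrite CE pred_iS /y; case: (b); rewrite ?andbF // andbT.
    by rewrite ord_pred_eqmax i_neq0.
  by rewrite /close_pivot -/y setD1K.
exact: card_inner_changes_cshift.
Qed.

End Internal.
End Words.

(** * Standard tableaux as placements of letters *)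

(** The pairs of cells whose entries a standard filling must have in increasing
    order; a standard filling is one that is increasing for this relation, in
    which rows and columns play the same role. *)
Definition precedes (c d : cell) : bool :=
  (c.1 == d.1) && (c.2 < d.2)%R || (c.2 == d.2) && (c.1 < d.1)%R.

Lemma precedes_total c d : c.1 = d.1 \/ c.2 = d.2 ->
  [\/ c = d, precedes c d | precedes d c].
Proof.
have [eq_cd|neq_cd] := eqVneq c d; first by constructor 1.
move: neq_cd; rewrite /precedes -pair_eqE /= => neq_cd aligned.
case lt_cd: ((c.1 == d.1) && (c.2 < d.2)%R || (c.2 == d.2) && (c.1 < d.1)%R).
  by constructor 2.
by constructor 3; lia.
Qed.

Section Placements.
Variable n : nat.
Implicit Types (D : pred cell) (f g : 'I_n.+1 -> cell) (i j v : 'I_n.+1).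

(** The inverse of a standard tableau, for an arbitrary set of [n.+1] cells. The
    cells form a mere predicate, so that shapes can be rotated and transposed. *)
Definition placement D f : Prop :=
  [/\ injective f, forall c, D c <-> exists i, f i = c
    & forall i j, precedes (f i) (f j) -> i < j].

Lemma eq_placement D D' f : D =1 D' -> placement D f -> placement D' f.
Proof. by move=> eqD [f_inj Df f_std]; split=> // c; rewrite -eqD. Qed.

Lemma placement_in D f i : placement D f -> D (f i).
Proof. by case=> _ Df _; apply/Df; exists i. Qed.

(** At the first letter [i] placed differently, the two cells of [i] are
    comparable, and the smaller one receives a letter larger than [i] in the
    tableau where it does not hold [i], against the order in that tableau. *)
Lemma placement_inj D f g : placement D f -> placement D g ->
  (forall i, (f i).1 = (g i).1 \/ (f i).2 = (g i).2) -> f =1 g.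
Proof.
move=> [f_inj Df f_std] [g_inj Dg g_std] aligned i.
have [m] := ubnP (nat_of_ord i); elim: m i => // m IH i lt_m.
have [j fj] : exists j, f j = g i by apply/Df/Dg; exists i.
have [l gl] : exists l, g l = f i by apply/Dg/Df; exists i.
have [lt_j|j_ge] := ltnP j i.
  have := fj; rewrite IH; last by lia.
  by move/g_inj => eq_j; move: lt_j; rewrite eq_j ltnn.
have [lt_l|l_ge] := ltnP l i.
  have := gl; rewrite -IH; last by lia.
  by move/f_inj => eq_l; move: lt_l; rewrite eq_l ltnn.
have [//|lt_fg|lt_gf] := precedes_total (aligned i).
  by have := g_std l i; rewrite gl lt_fg ltnNge l_ge => /(_ isT).
by have := f_std j i; rewrite fj lt_gf ltnNge j_ge => /(_ isT).
Qed.

Definition descents f : {set 'I_n.+1} :=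
  [set v | (v != ord_max) && ((f v).1 < (f (ordS v)).1)%R].

Lemma max_in_descents f : ord_max \notin descents f.
Proof. by rewrite inE eqxx. Qed.

Lemma card_placed D f (s : seq cell) : placement D f -> uniq s ->
  {subset s <= D} -> #|[set i | f i \in s]| = size s.
Proof.
move=> [f_inj Df _] s_uniq sD; rewrite cardE -(size_map f).
apply/perm_size/uniq_perm => // [|c]; first by rewrite map_inj_uniq ?enum_uniq.
apply/mapP/idP => [[i]|cs]; first by rewrite mem_enum inE => fi ->.
have [i fi] := (Df c).1 (sD c cs).
by exists i; rewrite // mem_enum inE fi.
Qed.

Definition rotate_placement f i := rot180 (f (rev_ord i)).
Definition transpose (c : cell) : cell := (c.2, c.1).

Lemma rot180K : involutive rot180.
Proof. by case=> a b; rewrite /rot180 /= !GRing.opprK. Qed.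

Lemma transposeK : involutive transpose.
Proof. by case. Qed.

Lemma precedes_rot180 c d : precedes (rot180 c) (rot180 d) = precedes d c.
Proof. by rewrite /precedes /=; lia. Qed.

Lemma placement_rotate D f :
  placement D f -> placement (D \o rot180) (rotate_placement f).
Proof.
move=> [f_inj Df f_std]; split=> [i j|c|i j].
- by move=> /(inv_inj rot180K) /f_inj /rev_ord_inj.
- apply: (iff_trans (Df _)); rewrite /rotate_placement; split=> -[i fi].
    by exists (rev_ord i); rewrite rev_ordK fi rot180K.
  by exists (rev_ord i); rewrite -fi rot180K.
by rewrite precedes_rot180 => /f_std /=; have := ltn_ord i; have := ltn_ord j; lia.
Qed.

Lemma placement_transpose D f :
  placement D f -> placement (D \o transpose) (transpose \o f).
Proof.
move=> [f_inj Df f_std]; split=> [i j|c|i j].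
- by move=> /(inv_inj transposeK) /f_inj.
- apply: (iff_trans (Df _)); split=> -[i fi]; exists i.
    by rewrite /= fi transposeK.
  by rewrite -fi /= transposeK.
by move=> prec; apply: f_std; move: prec; rewrite /precedes /= orbC.
Qed.

Lemma descents_rotate f : descents (rotate_placement f) = @flip n @^-1: descents f.
Proof.
apply/setP => v; rewrite !inE -(inj_eq (inv_inj (@flipK n))) flip_max.
rewrite /rotate_placement /flip ord_predK rev_ordS /=.
by congr (_ && _); lia.
Qed.

(** The role of [X] will be played by the standard tableaux of a fixed shape, each
    represented by its placement, or by the rotated or transposed placement. *)
Definition enumerates (X : finType) (pos : X -> 'I_n.+1 -> cell) D : Prop :=
  [/\ forall x, placement D (pos x), forall x x', pos x =1 pos x' -> x = x'
    & forall f, placement D f -> exists x, pos x =1 f].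

Lemma eq_enumerates (X : finType) (pos : X -> 'I_n.+1 -> cell) D D' :
  D =1 D' -> enumerates pos D -> enumerates pos D'.
Proof.
move=> eqD [pos_D pos_inj pos_onto]; split=> // [x|f Df].
  exact: eq_placement eqD (pos_D x).
by apply: pos_onto; apply: eq_placement Df => c; rewrite eqD.
Qed.

Lemma enumerates_rotate (X : finType) (pos : X -> 'I_n.+1 -> cell) D :
  enumerates pos D ->
  enumerates (fun x => rotate_placement (pos x)) (D \o rot180).
Proof.
move=> [pos_D pos_inj pos_onto].
have rotK f : rotate_placement (rotate_placement f) =1 f.
  by move=> i; rewrite /rotate_placement rot180K rev_ordK.
have eq_rot f g : f =1 g -> rotate_placement f =1 rotate_placement g.
  by move=> eqf i; rewrite /rotate_placement eqf.
split=> [x|x x' /eq_rot eq_pos|f /placement_rotate Df]; first exact: placement_rotate.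
  by apply: pos_inj => i; rewrite -rotK eq_pos rotK.
have [|x posx] := pos_onto (rotate_placement f).
  by apply: eq_placement Df => c; rewrite /= rot180K.
by exists x => i; rewrite (eq_rot _ _ posx) rotK.
Qed.

Lemma enumerates_transpose (X : finType) (pos : X -> 'I_n.+1 -> cell) D :
  enumerates pos D ->
  enumerates (fun x => transpose \o pos x) (D \o transpose).
Proof.
move=> [pos_D pos_inj pos_onto].
split=> [x|x x' eq_pos|f /placement_transpose Df]; first exact: placement_transpose.
  by apply: pos_inj => i; apply: (inv_inj transposeK); apply: eq_pos.
have [|x posx] := pos_onto (transpose \o f).
  by apply: eq_placement Df => c; rewrite /= transposeK.
by exists x => i; rewrite /= posx /= transposeK.
Qed.

Lemma index_enum_lt (A : {set 'I_n.+1}) i j : i \in A -> j \in A ->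
  (index i (enum A) < index j (enum A)) = (i < j).
Proof.
have A_sorted : sorted (relpre val ltn) (enum A).
  rewrite /enum_mem sorted_filter // => [x y z /=|]; first exact: ltn_trans.
  by rewrite -enumT -sorted_map val_enum_ord iota_ltn_sorted.
have index_lt i' j' : i' \in A -> j' \in A ->
    index i' (enum A) < index j' (enum A) -> i' < j'.
  move=> Ai Aj; apply: (@sorted_ltn_index _ (relpre val ltn)); rewrite ?mem_enum //.
  by move=> x y z /=; apply: ltn_trans.
move=> Ai Aj; apply/idP/idP => [|lt_ij]; first exact: index_lt.
rewrite ltnNge leq_eqVlt negb_or; apply/andP; split; last first.
  by apply/negP => /(index_lt _ _ Aj Ai); lia.
apply/eqP => /(congr1 (nth i (enum A))); rewrite !nth_index ?mem_enum // => eq_ij.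
by move: lt_ij; rewrite eq_ij ltnn.
Qed.

Section Chains.
Variables (I : eqType) (block : 'I_n.+1 -> I) (chain : I -> nat -> cell).

Definition block_set b := [set i | block i == b].
Definition block_rank i := index i (enum (block_set (block i))).

Lemma block_rank_lt i j : block i = block j ->
  (block_rank i < block_rank j) = (i < j).
Proof.
by move=> eq_b; rewrite /block_rank eq_b index_enum_lt // inE ?eq_b.
Qed.

Lemma block_rank_bound i : block_rank i < #|block_set (block i)|.
Proof. by rewrite /block_rank cardE index_mem mem_enum inE. Qed.

Lemma block_rank_onto b t : t < #|block_set b| ->
  exists i, block i = b /\ block_rank i = t.
Proof.
rewrite cardE => lt_t; have [i0 _] : exists i0, i0 \in enum (block_set b).
  by case: (enum _) lt_t => [//|i0 s] _; exists i0; rewrite mem_head.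
have := mem_nth i0 lt_t; rewrite mem_enum inE => /eqP block_i.
exists (nth i0 (enum (block_set b)) t).
by rewrite /block_rank block_i index_uniq ?enum_uniq.
Qed.

(** Placing each block of letters in increasing order along a chain of cells
    yields a standard tableau as soon as the order relations between different
    chains are respected. *)
Lemma placement_chains D :
  (forall c, D c <-> exists b t, t < #|block_set b| /\ c = chain b t) ->
  (forall b s b' t, s < #|block_set b| -> t < #|block_set b'| ->
     chain b s = chain b' t -> b = b' /\ s = t) ->
  (forall b s t, precedes (chain b s) (chain b t) -> s < t) ->
  (forall i j, block i != block j ->
     precedes (chain (block i) (block_rank i)) (chain (block j) (block_rank j)) ->
     i < j) ->
  placement D (fun i => chain (block i) (block_rank i)).
Proof.
move=> D_chain chain_inj chain_mono cross; split=> [i j|c|i j].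
- case/chain_inj; rewrite ?block_rank_bound // => eq_b eq_r.
  have [lt_ij|lt_ji|/val_inj//] := ltngtP i j.
    by move: lt_ij; rewrite -(block_rank_lt eq_b) eq_r ltnn.
  by move: lt_ji; rewrite -(block_rank_lt (esym eq_b)) eq_r ltnn.
- apply: (iff_trans (D_chain c)); split=> [[b [t [lt_t ->]]]|[i <-]].
    by have [i [<- <-]] := block_rank_onto lt_t; exists i.
  by exists (block i), (block_rank i); split=> //; apply: block_rank_bound.
have [eq_b|/cross//] := eqVneq (block i) (block j).
by rewrite eq_b => /chain_mono; rewrite block_rank_lt.
Qed.

End Chains.

End Placements.

(** * Near-hooks as sets of integer points *)

Definition row_cells (p : cell) (a : nat) (c : cell) : bool :=
  (c.1 == p.1) && (p.2 <= c.2)%R && (c.2 < p.2 + a%:Z)%R.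
Definition col_cells (p : cell) (b : nat) (c : cell) : bool :=
  (c.2 == p.2) && (p.1 <= c.1)%R && (c.1 < p.1 + b%:Z)%R.

(** The column of a hook with corner [p], without its corner. *)
Definition leg_cells (p : cell) (k : nat) : pred cell :=
  col_cells ((p.1 + 1)%R, p.2) k.-1.

Lemma row_cellsP (p : cell) (a : nat) (c : cell) :
  reflect (exists2 t, t < a & c = (p.1, (p.2 + t%:Z)%R)) (row_cells p a c).
Proof.
case: c => c1 c2; rewrite /row_cells /=.
apply: (iffP idP) => [c_row|[t t_lt [-> ->]]]; last by lia.
by exists `|(c2 - p.2)%R|%N; [lia|congr (_, _); lia].
Qed.

Lemma col_cellsP (p : cell) (b : nat) (c : cell) :
  reflect (exists2 t, t < b & c = ((p.1 + t%:Z)%R, p.2)) (col_cells p b c).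
Proof.
case: c => c1 c2; rewrite /col_cells /=.
apply: (iffP idP) => [c_col|[t t_lt [-> ->]]]; last by lia.
by exists `|(c1 - p.1)%R|%N; [lia|congr (_, _); lia].
Qed.

Lemma eq_cellE (c d : cell) : (c == d) = (c.1 == d.1) && (c.2 == d.2).
Proof. by []. Qed.

Section Shapes.
Variable n : nat.
Implicit Types (p q c : cell) (f : 'I_n.+1 -> cell).
Implicit Types (i j v z : 'I_n.+1) (C : {set 'I_n.+1}).

Lemma eq_cyclic_family k (X : finType) (des des' : X -> {set 'I_n.+1}) :
  des =1 des' -> cyclic_family k des -> cyclic_family k des'.
Proof.
move=> eq_des [des'max card_cyc inv]; split=> [x|x|S]; rewrite -?eq_des //.
have eq_fiber S' :
    [set x | cyc_close k (des' x) == S'] = [set x | cyc_close k (des x) == S'].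
  by apply/setP=> x; rewrite !inE eq_des.
by rewrite !eq_fiber inv.
Qed.

(** All that is used about two consecutive letters when reading off descents. *)
Lemma placement_step D f v : placement D f -> v != ord_max ->
  (f (ordS v) != f v) && ~~ precedes (f (ordS v)) (f v).
Proof.
move=> [f_inj _ f_std] v_neq; have v_S := val_ordS v_neq.
apply/andP; split; last by apply/negP => /f_std; rewrite v_S; lia.
by apply/eqP => /f_inj eq_v; move: v_S; rewrite eq_v; lia.
Qed.

Definition letters_in (P : pred cell) f : {set 'I_n.+1} := [set i | P (f i)].

Lemma card_col_cells D f p b : placement D f ->
  (forall c, col_cells p b c -> D c) -> #|letters_in (col_cells p b) f| = b.
Proof.
move=> Df colD; pose s : seq cell := [seq ((p.1 + t%:Z)%R, p.2) | t <- iota 0 b].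
have sE c : (c \in s) = col_cells p b c.
  apply/mapP/col_cellsP => -[t]; rewrite ?mem_iota; exists t => //.
  by rewrite mem_iota.
have ->: letters_in (col_cells p b) f = [set i | f i \in s].
  by apply/setP=> i; rewrite !inE sE.
rewrite (card_placed Df) ?size_map ?size_iota // => [|c]; last by rewrite sE => /colD.
by rewrite map_inj_uniq ?iota_uniq // => t t' [] /(GRing.addrI _) [].
Qed.

(** Compares the letter at a known place of its chain with any other letter of the
    block, of which only a bound for the rank is available. *)
Lemma min_block_le (I : eqType) (block : 'I_n.+1 -> I) i j t :
  block i = block j -> block_rank block i <= t -> t <= block_rank block j -> i <= j.
Proof. by move=> eq_b; have := block_rank_lt (esym eq_b); lia. Qed.

Section MinusCorner.
Variables (k m : nat) (p q : cell) (D : pred cell) (X : finType).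
Variable pos : X -> 'I_n.+1 -> cell.
Hypotheses (k_gt0 : 0 < k) (m_gt0 : 0 < m) (size_D : k + m = n.+1).
Hypotheses (q_above : (q.1 < p.1)%R) (q_right : (p.2 < q.2)%R).
Hypothesis D_eq : D =1 (fun c => col_cells p k c || row_cells q m c).
Hypothesis pos_D : enumerates pos D.

Let leg x := letters_in (col_cells p k) (pos x).

Let card_leg x : #|leg x| = k.
Proof.
have [/(_ x) posD _ _] := pos_D; apply: card_col_cells posD _ => c.
by rewrite D_eq => ->.
Qed.

Let des_leg x : descents (pos x) = cunshift (leg x) :\ ord_max.
Proof.
have [/(_ x) posD _ _] := pos_D; apply/setP=> v; rewrite !inE.
have [//|v_neq] := eqVneq v ord_max; have := placement_step posD v_neq.
have := placement_in v posD; have := placement_in (ordS v) posD; rewrite !D_eq.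
rewrite eq_cellE /precedes /col_cells /row_cells /=; lia.
Qed.

Lemma minus_corner_shape :
  cyclic_family k (fun x => descents (pos x)) /\
  forall x, (#|descents (pos x)| == k.-1)
            = (ord0 \in letters_in (col_cells p k) (pos x)).
Proof.
split; last exact: (minus_corner_max (C := leg)).
apply: (minus_corner_family k_gt0 card_leg des_leg) => [x x' eq_leg|A card_A].
  have [posD pos_inj _] := pos_D; apply: pos_inj.
  apply: (placement_inj (posD x) (posD x')) => i.
  have := congr1 (fun A : {set 'I_n.+1} => i \in A) eq_leg; rewrite !inE.
  have := placement_in i (posD x); have := placement_in i (posD x'); rewrite !D_eq.
  rewrite /col_cells /row_cells; lia.
pose block i := i \in A.
pose chain (b : bool) (t : nat) : cell :=
  if b then ((p.1 + t%:Z)%R, p.2) else (q.1, (q.2 + t%:Z)%R).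
have blockT : #|block_set block true| = k.
  by rewrite -card_A; apply: eq_card => i; rewrite inE eqb_id.
have blockF : #|block_set block false| = m.
  have := cardsC A; rewrite card_ord card_A => card_C.
  transitivity #|~: A|; last by card_lia.
  by apply: eq_card => i; rewrite !inE eqbF_neg.
have [_ _ pos_onto] := pos_D.
have [|x posx] := pos_onto (fun i => chain (block i) (block_rank block i)).
  apply: placement_chains.
  - move=> c; rewrite D_eq.
    split=> [/orP[/col_cellsP|/row_cellsP] [t lt_t ->]|[b [t [lt_t ->]]]].
    + by exists true, t; rewrite blockT.
    + by exists false, t; rewrite blockF.
    by case: b lt_t; rewrite ?blockT ?blockF /col_cells /row_cells /=; lia.
  - move=> [] s [] t; rewrite ?blockT ?blockF => lt_s lt_t []; split=> //; lia.
  - by case=> s t; rewrite /precedes /=; lia.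
  by move=> i j; case: (block i) (block j) => [] []; rewrite /precedes /=; lia.
exists x; apply/setP=> i; rewrite inE posx -/(block i).
have := block_rank_bound block i.
by case: (block i); rewrite ?blockT ?blockF /col_cells /=; lia.
Qed.

End MinusCorner.
Definition hook_cells (p : cell) (a k : nat) (c : cell) : bool :=
  row_cells p a c || col_cells p k c.

(** The blocks of a hook with one extra cell [c0] are the marked letter [None], the
    leg [Some true], and the arm with the corner [Some false]. *)
Definition mark_block C z i : option bool := if i == z then None else Some (i \in C).

Definition mark_chain (p c0 : cell) (b : option bool) (t : nat) : cell :=
  match b with
  | None => c0
  | Some true => ((p.1 + 1 + t%:Z)%R, p.2)
  | Some false => (p.1, (p.2 + t%:Z)%R)
  end.

Section MarkedBlocks.
Variables (a k : nat) (C : {set 'I_n.+1}) (z : 'I_n.+1).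
Hypotheses (k_gt0 : 0 < k) (size_D : a + k = n.+1).
Hypotheses (C'z : z \notin C) (card_C : #|C| = k.-1).
Local Notation block := (mark_block C z).

Lemma mark_blockP i :
  [\/ i = z /\ block i = None, i \in C /\ block i = Some true
    | [/\ i != z, i \notin C & block i = Some false]].
Proof.
rewrite /mark_block; have [->|i_neq] := eqVneq i z; first by constructor 1.
by case: (boolP (i \in C)); [constructor 2|constructor 3].
Qed.

Lemma card_mark_block b : #|block_set block b| =
  match b with None => 1 | Some true => k.-1 | Some false => a end.
Proof.
have blockN : block_set block None = [set z].
  by apply/setP=> i; rewrite !inE /mark_block; have [_|_] := eqVneq i z.
have blockT : block_set block (Some true) = C.
  apply/setP=> i; rewrite !inE /mark_block; have [->|_] := eqVneq i z.
    by rewrite (negPf C'z).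
  by case: (i \in C).
have blockF : block_set block (Some false) = ~: (z |: C).
  apply/setP=> i; rewrite !inE /mark_block; have [->|_] := eqVneq i z; first by [].
  by case: (i \in C).
case: b => [[]|]; rewrite ?blockN ?blockT ?blockF ?cards1 //.
have := cardsC (z |: C); rewrite cardsU1 C'z card_C card_ord /=; card_lia.
Qed.

Lemma mark_placement (D : pred cell) (p c0 : cell) :
  D =1 (fun c => hook_cells p a k c || (c == c0)) ->
  0 < a -> ~~ hook_cells p a k c0 ->
  (forall i j, block i != block j ->
     precedes (mark_chain p c0 (block i) (block_rank block i))
              (mark_chain p c0 (block j) (block_rank block j)) -> i < j) ->
  placement D (fun i => mark_chain p c0 (block i) (block_rank block i)).
Proof.
move=> D_eq a_gt0 c0_out cross; apply: placement_chains cross => [c|b s b' t|b s t].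
- rewrite D_eq; split=> [|[b [t []]]]; last first.
    rewrite card_mark_block => lt_t ->; apply/orP.
    case: b lt_t => [[]|] lt_t; last by right.
      by left; rewrite /hook_cells /col_cells /row_cells /=; lia.
    by left; rewrite /hook_cells /col_cells /row_cells /=; lia.
  case/orP => [|/eqP ->]; last by exists None, 0; rewrite card_mark_block.
  have [/row_cellsP[t lt_t ->] _|not_row] := boolP (row_cells p a c).
    by exists (Some false), t; rewrite card_mark_block.
  rewrite /hook_cells (negPf not_row) => /= /col_cellsP[t lt_t c_eq].
  have t_gt0 : 0 < t by move: not_row; rewrite c_eq /row_cells /=; lia.
  exists (Some true), t.-1; rewrite card_mark_block c_eq; split; first by lia.
  by congr (_, _); lia.
- rewrite !card_mark_block; move: c0_out; rewrite /hook_cells /row_cells /col_cells.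
  move=> c0_out lt_s lt_t eq_c; have := congr1 fst eq_c; have := congr1 snd eq_c.
  by case: b b' lt_s lt_t {eq_c} => [[]|] [[]|] /= *; split=> //; lia.
by case: b => [[]|]; rewrite /precedes /=; lia.
Qed.

Lemma mark_chain_leg p c0 i : ~~ leg_cells p k c0 ->
  leg_cells p k (mark_chain p c0 (block i) (block_rank block i)) = (i \in C).
Proof.
move=> c0_out; have := block_rank_bound block i; rewrite card_mark_block.
have [[-> ->]|[-> ->]|[_ /negPf-> ->]] := mark_blockP i.
- by rewrite (negPf C'z) (negPf c0_out).
- by rewrite /leg_cells /col_cells /=; lia.
by rewrite /leg_cells /col_cells /=; lia.
Qed.

Lemma mark_chain_mark p c0 :
  mark_chain p c0 (block z) (block_rank block z) = c0.
Proof. by rewrite {1}/mark_block eqxx. Qed.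

End MarkedBlocks.

Section Marked.
Variables (a k : nat) (p c0 : cell) (D : pred cell) (X : finType).
Variables (pos : X -> 'I_n.+1 -> cell) (mark : X -> 'I_n.+1).
Hypotheses (n_gt0 : 0 < n) (k_gt0 : 0 < k) (a_gt0 : 0 < a) (size_D : a + k = n.+1).
Hypothesis D_eq : D =1 (fun c => hook_cells p a k c || (c == c0)).
Hypothesis c0_out : ~~ hook_cells p a k c0.
Hypothesis pos_D : enumerates pos D.
Hypothesis pos_mark : forall x, pos x (mark x) = c0.

Let leg x := letters_in (leg_cells p k) (pos x).

Let posD x : placement D (pos x).
Proof. by case: pos_D. Qed.

Let leg_in_hook c : leg_cells p k c -> hook_cells p a k c.
Proof. by rewrite /hook_cells /leg_cells /col_cells /=; lia. Qed.

Lemma mark_out x i : i != mark x -> hook_cells p a k (pos x i).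
Proof.
move=> i_neq; have [x_inj _ _] := posD x; have := placement_in i (posD x).
by rewrite D_eq -(pos_mark x) (inj_eq x_inj) (negPf i_neq) orbF.
Qed.

Lemma corner_letter x : exists j,
  [/\ pos x j = p, j != mark x & forall i, i != mark x -> i != j -> j < i].
Proof.
have [x_inj Dpos pos_std] := posD x.
have p_hook : hook_cells p a k p by rewrite /hook_cells /row_cells; lia.
have [|j posj] := (Dpos p).1; first by rewrite D_eq p_hook.
exists j; split=> // [|i i_neq].
  by apply: contraNneq c0_out => eq_j; rewrite -(pos_mark x) -eq_j posj.
rewrite -(inj_eq x_inj) posj eq_cellE => neq_p.
apply: pos_std; rewrite posj; have := mark_out i_neq; move: neq_p.
by rewrite /hook_cells /precedes /row_cells /col_cells; lia.
Qed.

(** What the words have in common for every position of the extra cell. *)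
Lemma leg_word x : [/\ mark x \notin leg x, #|leg x| = k.-1
  & forall i, i \in leg x -> exists j, [/\ pos x j = p, j != mark x & j < i]].
Proof.
have mark'leg : mark x \notin leg x.
  by rewrite inE pos_mark; apply: contra c0_out => /leg_in_hook.
split=> // [|i i_leg].
  by apply: card_col_cells (posD x) _ => c /leg_in_hook; rewrite D_eq => ->.
have [j [posj j_neq j_min]] := corner_letter x; exists j; split=> //.
apply: j_min; first by apply: contraNneq mark'leg => <-.
apply: contraTneq i_leg => ->.
by rewrite inE posj /leg_cells /col_cells /=; lia.
Qed.

Lemma mark_inj x x' : leg x = leg x' -> mark x = mark x' -> x = x'.
Proof.
have [_ pos_inj _] := pos_D => eq_leg eq_mark; apply: pos_inj.
apply: (placement_inj (posD x) (posD x')) => i.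
have [->|i_neq] := eqVneq i (mark x).
  by rewrite pos_mark eq_mark pos_mark; left.
have i_neq' : i != mark x' by rewrite -eq_mark.
have not_c0 t : i != mark t -> pos t i != c0.
  have [t_inj _ _] := posD t.
  by apply: contra_neq => posi; apply: t_inj; rewrite pos_mark.
have := congr1 (fun A : {set 'I_n.+1} => i \in A) eq_leg; rewrite !inE.
have := placement_in i (posD x); have := placement_in i (posD x').
rewrite !D_eq (negPf (not_c0 _ i_neq)) (negPf (not_c0 _ i_neq')) !orbF.
by rewrite /hook_cells /leg_cells /col_cells /row_cells /=; lia.
Qed.

Lemma mark_onto C z : z \notin C -> #|C| = k.-1 ->
  (forall i j, mark_block C z i != mark_block C z j ->
     precedes (mark_chain p c0 (mark_block C z i) (block_rank (mark_block C z) i))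
              (mark_chain p c0 (mark_block C z j) (block_rank (mark_block C z) j)) ->
     i < j) ->
  exists x, leg x = C /\ mark x = z.
Proof.
move=> C'z card_C cross; have [_ _ pos_onto] := pos_D.
have [|x posx] := pos_onto
  (fun i => mark_chain p c0 (mark_block C z i) (block_rank (mark_block C z) i)).
  by apply: (mark_placement k_gt0 size_D C'z card_C D_eq).
exists x; split.
  apply/setP=> i; rewrite inE posx (mark_chain_leg k_gt0 size_D) //.
  by apply: contra c0_out => /leg_in_hook.
have [x_inj _ _] := posD x; apply: x_inj.
by rewrite pos_mark posx mark_chain_mark.
Qed.

Lemma NE_cell_shape : (c0.1 < p.1)%R -> (p.2 + a%:Z <= c0.2)%R ->
  cyclic_family k (fun x => descents (pos x)) /\
  forall x, (#|descents (pos x)| == k.-1)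
            = (mark x == ord_max) || (ordS (mark x) \in leg x).
Proof.
move=> c0_above c0_right.
have word_x x : disconnected_word k (leg x) (mark x).
  have [C'z card_C corner] := leg_word x; split=> //.
    by apply/negP => /corner[j [_ _]]; rewrite ltn0.
  apply/negP => /andP[/eqP mark0 /corner[j [_ j_neq j_lt]]].
  move: j_neq j_lt; rewrite mark0 val_ordS -?val_eqE /=; lia.
have des_word x : descents (pos x) =
    [set v | (v != ord_max) && ((ordS v \in leg x) || (v == mark x))].
  have [x_inj _ _] := posD x; apply/setP=> v; rewrite !inE.
  have [//|v_neq] := eqVneq v ord_max; have := placement_step (posD x) v_neq.
  rewrite -(inj_eq x_inj) pos_mark.
  have := placement_in v (posD x); have := placement_in (ordS v) (posD x).
  rewrite !D_eq.
  rewrite !eq_cellE /precedes /hook_cells /leg_cells /col_cells /row_cells /=; lia.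
split; last exact: (disconnected_max k_gt0 word_x des_word).
apply: (disconnected_family k_gt0 word_x des_word n_gt0) => [|C z].
  exact: mark_inj.
case=> C'z card_C C'0 corner; apply: mark_onto => // i j.
set block := mark_block C z.
move: (block_rank_bound block i) (block_rank_bound block j).
have arm_le r : r \notin C -> r != z -> block i = Some false ->
    block_rank block i = 0 -> i <= r.
  move=> C'r r_neq block_i rank_i; apply: (@min_block_le _ block i r 0) => //.
    by rewrite block_i /block /mark_block (negPf r_neq) (negPf C'r).
  by rewrite rank_i.
rewrite !(card_mark_block k_gt0 size_D) // /precedes.
have [[-> bi]|[iC bi]|[i_neq C'i bi]] := mark_blockP C z i;
have [[-> bj]|[jC bj]|[j_neq C'j bj]] := mark_blockP C z j;
rewrite /block ?bi ?bj /= ?eqxx // => i_bound j_bound _; try by lia.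
(* The corner receives the smallest letter of the arm, which is 0 or 1. *)
move=> corner_prec; have rank_i0 : block_rank block i = 0 by rewrite /block; lia.
have j_neq0 : j != ord0 by apply: contraNneq C'0 => <-.
have [z0|z_neq0] := eqVneq z ord0; last first.
  have := arm_le ord0 C'0; rewrite eq_sym => /(_ z_neq0 bi rank_i0).
  by move: j_neq0; rewrite -val_eqE /=; lia.
have neq0_max : (ord0 : 'I_n.+1) != ord_max by rewrite -val_eqE /=; lia.
move: corner; rewrite z0 eqxx /= => C'1; have S0 := val_ordS neq0_max.
have j_neq1 : j != ordS ord0 by apply: contraNneq C'1 => <-.
have := arm_le _ C'1; rewrite z0 ordS_eq0 => /(_ neq0_max bi rank_i0).
by move: j_neq0 j_neq1; rewrite -!(inj_eq (@ord_inj _)) S0 /=; lia.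
Qed.

Lemma internal_cell_shape : c0 = ((p.1 + 1)%R, (p.2 + 1)%R) -> 1 < a -> 1 < k ->
  cyclic_family k (fun x => descents (pos x)) /\
  forall x, (#|descents (pos x)| == k.-1)
            = (mark x != ord0) && (ord_pred (mark x) \in leg x).
Proof.
move=> c0_eq a_gt1 k_gt1.
have word_x x : internal_word k (leg x) (mark x).
  have [C'z card_C corner] := leg_word x; have [_ Dpos pos_std] := posD x.
  have hook_letter c : hook_cells p a k c -> exists i, pos x i = c.
    by move=> c_hook; apply/(Dpos c); rewrite D_eq c_hook.
  split=> //.
  - by apply/negP => /corner[j [_ _]]; rewrite ltn0.
  - have [|c posc] := hook_letter ((p.1 + 1)%R, p.2).
      by rewrite /hook_cells /col_cells /row_cells /=; lia.
    exists c; first by rewrite inE posc /leg_cells /col_cells /=; lia.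
    by apply: pos_std; rewrite posc pos_mark c0_eq /precedes /=; lia.
  have [|w posw] := hook_letter (p.1, (p.2 + 1)%R).
    by rewrite /hook_cells /col_cells /row_cells /=; lia.
  have [|j posj] := hook_letter p.
    by rewrite /hook_cells /col_cells /row_cells /=; lia.
  exists w; first by rewrite inE posw /leg_cells /col_cells /=; lia.
  have j_lt : j < w by apply: pos_std; rewrite posj posw /precedes /=; lia.
  rewrite (leq_ltn_trans _ j_lt) //=.
  by apply: pos_std; rewrite posw pos_mark c0_eq /precedes /=; lia.
have des_word x : descents (pos x) =
    [set v | (v != ord_max)
             && ((ordS v \in leg x) || ((ordS v == mark x) && (v \notin leg x)))].
  have [x_inj _ _] := posD x; apply/setP=> v; rewrite !inE.
  have [//|v_neq] := eqVneq v ord_max; have := placement_step (posD x) v_neq.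
  rewrite -(inj_eq x_inj) pos_mark.
  have := placement_in v (posD x); have := placement_in (ordS v) (posD x).
  rewrite !D_eq.
  rewrite !eq_cellE /precedes /hook_cells /leg_cells /col_cells /row_cells c0_eq /=.
  by lia.
split=> [|x]; last first.
  have [_ _ _ [c _ c_lt] _] := word_x x.
  have -> : mark x != ord0 by rewrite -val_eqE /=; lia.
  exact: (internal_max k_gt0 word_x des_word).
apply: (internal_family k_gt0 word_x des_word n_gt0) => [|C z]; first exact: mark_inj.
case=> C'z card_C C'0 [c cC c_lt] [w C'w w_lt]; apply: mark_onto => // i j.
set block := mark_block C z.
move: (block_rank_bound block i) (block_rank_bound block j).
have z_neq0 : ord0 != z by rewrite -val_eqE /=; lia.
have block0 : block ord0 = Some false.
  by rewrite /block /mark_block (negPf z_neq0) (negPf C'0).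
have blockw : block w = Some false.
  by rewrite /block /mark_block (negPf C'w) ifN //; rewrite -val_eqE /=; lia.
have blockc : block c = Some true.
  by rewrite /block /mark_block cC ifN //; rewrite -val_eqE /=; lia.
have rank_w : 0 < block_rank block w.
  have rank_lt : block_rank block ord0 < block_rank block w.
    by rewrite block_rank_lt ?block0 ?blockw //; case/andP: w_lt.
  exact: leq_ltn_trans rank_lt.
have rank_le r t := @min_block_le _ block i r t.
rewrite !(card_mark_block k_gt0 size_D) // /precedes c0_eq.
have [[-> bi]|[iC bi]|[i_neq C'i bi]] := mark_blockP C z i;
have [[-> bj]|[jC bj]|[j_neq C'j bj]] := mark_blockP C z j;
rewrite /block ?bi ?bj /= ?eqxx // => i_bound j_bound _; try by lia.
(* Leg against [c0]: the first cell of the leg holds the minimum of [C]. *)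
- move=> prec; have := rank_le c 0; rewrite blockc -/block in prec * => /(_ bi).
  by lia.
(* Arm against [c0]: the cell next to the corner holds the second letter of the
   arm, and [0] is the first. *)
- move=> prec; have := rank_le w 1; rewrite blockw -/block in prec * => /(_ bi).
  by lia.
(* Corner against leg: the corner holds [0]. *)
move=> prec; have := rank_le ord0 0; rewrite block0 -/block in prec * => /(_ bi).
have j_neq0 : j != ord0 by apply: contraNneq C'0 => <-.
by move: j_neq0; rewrite -val_eqE /=; lia.
Qed.

End Marked.

(** Transposition exchanges the two positions of the extra cell. As no letter is
    followed by one strictly to the southeast or to the northwest, it also
    exchanges descents and ascents, so that [cyclic_familyC] applies. *)
Lemma SW_cell_shape (a k : nat) (p c0 : cell) (D : pred cell) (X : finType)
    (pos : X -> 'I_n.+1 -> cell) (mark : X -> 'I_n.+1) :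
  0 < n -> 0 < k -> 0 < a -> a + k = n.+1 ->
  D =1 (fun c => hook_cells p a k c || (c == c0)) ->
  (c0.2 < p.2)%R -> (p.1 + k%:Z <= c0.1)%R ->
  enumerates pos D -> (forall x, pos x (mark x) = c0) ->
  cyclic_family k (fun x => descents (pos x)) /\
  forall x, (#|descents (pos x)| == k.-1)
            = (mark x == ord0)
              || (mark x != ord_max)
                 && (ordS (mark x) \in letters_in (leg_cells p k) (pos x)).
Proof.
move=> n_gt0 k_gt0 a_gt0 size_D D_eq c0_left c0_below pos_D pos_mark.
have c0_out : ~~ hook_cells p a k c0.
  by rewrite /hook_cells /row_cells /col_cells; lia.
have [posD _ _] := pos_D.
have tr_D : D \o transpose =1
    (fun c => hook_cells (transpose p) k a c || (c == transpose c0)).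
  move=> c; rewrite /= D_eq !eq_cellE /hook_cells /row_cells /col_cells /=; lia.
have tr_out : ~~ hook_cells (transpose p) k a (transpose c0).
  by move: c0_out; rewrite /hook_cells /row_cells /col_cells /=; lia.
have size_tr : k + a = n.+1 by rewrite addnC.
have tr_mark x : (transpose \o pos x) (mark x) = transpose c0 by rewrite /= pos_mark.
have [family_tr max_tr] := NE_cell_shape n_gt0 a_gt0 k_gt0 size_tr tr_D tr_out
  (enumerates_transpose pos_D) tr_mark c0_left c0_below.
have des_tr x : ~: (ord_max |: descents (transpose \o pos x)) = descents (pos x).
  apply/setP=> v; rewrite !inE; have [//|v_neq] := eqVneq v ord_max.
  have := placement_step (posD x) v_neq.
  have := placement_in v (posD x); have := placement_in (ordS v) (posD x).
  rewrite !D_eq.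
  by rewrite !eq_cellE /precedes /hook_cells /col_cells /row_cells /=; lia.
have a_le : a <= n by lia.
split.
  apply: (eq_cyclic_family des_tr); have -> : k = n.+1 - a by lia.
  exact: cyclic_familyC.
move=> x; have [card_tr1 card_tr2] := cyclic_family_card_des x a_gt0 family_tr.
have := cardsC (ord_max |: descents (transpose \o pos x)).
rewrite des_tr cardsU1 max_in_descents card_ord => card_C.
have -> : (#|descents (pos x)| == k.-1) = ~~ (#|descents (transpose \o pos x)| == a.-1).
  by move: card_C card_tr1 card_tr2; card_lia.
have [j [posj j_neq j_min]] :=
  corner_letter n_gt0 k_gt0 a_gt0 size_D D_eq c0_out pos_D pos_mark x.
have [x_inj _ _] := posD x; rewrite max_tr !inE /=.
have [mark_max|mark_neq] := eqVneq (mark x) ord_max.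
  have mark_neq0 : mark x != ord0 by rewrite mark_max -val_eqE /=; lia.
  by rewrite (negPf mark_neq0).
have mark_S := val_ordS mark_neq.
have S_neq : ordS (mark x) != mark x by rewrite -(inj_eq (@ord_inj _)) mark_S; lia.
have S_hook := mark_out D_eq pos_D pos_mark S_neq.
(* The letter after the mark is in the corner exactly when the mark is [0]; else
   it is in the leg or in the arm, and only the leg is wanted. *)
have S_corner : (pos x (ordS (mark x)) == p) = (mark x == ord0).
  rewrite -posj (inj_eq x_inj); apply/eqP/eqP => [Sj|mark0].
    apply/eqP; apply: contraT; rewrite eq_sym => neq0; have := j_min _ neq0.
    by rewrite -Sj -!(inj_eq (@ord_inj _)) mark_S /= => /(_ isT).
  apply/eqP; apply: contraT => /(j_min _ S_neq); rewrite mark_S mark0 ltnS leqn0.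
  by move: j_neq; rewrite mark0 -val_eqE /= => /negPf->.
rewrite -S_corner; move: S_hook; rewrite eq_cellE.
by rewrite /hook_cells /leg_cells /row_cells /col_cells /=; lia.
Qed.

End Shapes.

(** * Recognizing the near-hooks *)

Lemma mem_diagram (p c : cell) (la : seq nat) :
  (c \in diagram p la) <-> exists i j,
    [/\ i < size la, j < nth 0 la i & c = ((p.1 + i%:Z)%R, (p.2 + j%:Z)%R)].
Proof.
split=> [/mapP[d /allpairsPdep[i [j []]]]|[i [j [i_lt j_lt ->]]]].
  by rewrite !mem_iota nth_nil subn0 => i_lt j_lt -> ->; exists i, j.
apply/mapP; exists (Posz i, Posz j) => //; apply/allpairsPdep; exists i, j.
by rewrite !mem_iota nth_nil subn0.
Qed.

Lemma mem_column p k : diagram p (nseq k 1) =i col_cells p k.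
Proof.
move=> c; apply/idP/col_cellsP => [/mem_diagram[i [j]]|[t t_lt ->]].
  rewrite size_nseq nth_nseq => -[i_lt]; rewrite i_lt ltnS leqn0 => /eqP-> ->.
  by exists i; rewrite ?GRing.addr0.
by apply/mem_diagram; exists t, 0; rewrite size_nseq nth_nseq t_lt GRing.addr0.
Qed.

Lemma mem_row p m : diagram p [:: m] =i row_cells p m.
Proof.
move=> c; apply/idP/row_cellsP => [/mem_diagram[i [j]]|[t t_lt ->]].
  by case; case: i => [|i] //= _ j_lt ->; exists j; rewrite ?GRing.addr0.
by apply/mem_diagram; exists 0, t; rewrite GRing.addr0.
Qed.

Lemma mem_hook_column p k : hook_column p k =i leg_cells p k.
Proof.
by move=> c; rewrite mem_column -!topredE /leg_cells /col_cells /=; lia.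
Qed.

Lemma mem_hook p n k : 0 < k -> 0 < n - k ->
  diagram p (hook n k) =i hook_cells p (n - k) k.
Proof.
move=> k_gt0 a_gt0 c; apply/idP/orP => [/mem_diagram[i [j []]]|].
  rewrite /= size_nseq; case: i => [|i] /= i_lt.
    by move=> j_lt ->; left; apply/row_cellsP; exists j; rewrite ?GRing.addr0.
  rewrite nth_nseq ifT // ltnS leqn0 => /eqP-> ->; right; apply/col_cellsP.
  by exists i.+1; rewrite ?GRing.addr0 //; lia.
case=> [/row_cellsP|/col_cellsP] [t t_lt ->]; apply/mem_diagram.
  by exists 0, t; rewrite GRing.addr0.
exists t, 0; rewrite GRing.addr0 /= size_nseq; split=> //; first by lia.
by case: t t_lt => [|t] t_lt //=; rewrite nth_nseq ifT //; lia.
Qed.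

Lemma mem_internal p n k : 1 < k -> 1 < n - k ->
  diagram p [:: n - k, 2 & nseq (k - 2) 1]
  =i predU1 ((p.1 + 1)%R, (p.2 + 1)%R) (hook_cells p (n - k) k).
Proof.
move=> k_gt1 a_gt1 c; rewrite [RHS]inE; apply/idP/orP => [/mem_diagram[i [j []]]|].
  rewrite /= size_nseq; case: i => [|[|i]] /= i_lt.
  - move=> j_lt ->; right; apply/orP; left; apply/row_cellsP.
    by exists j; rewrite ?GRing.addr0.
  - case: j => [|[|//]] _ ->; last by left.
    right; apply/orP; right; apply/col_cellsP.
    by exists 1; rewrite ?GRing.addr0 //; lia.
  rewrite nth_nseq ifT // ltnS leqn0 => /eqP-> ->.
  right; apply/orP; right; apply/col_cellsP.
  by exists i.+2; rewrite ?GRing.addr0 //; lia.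
case=> [/eqP->|/orP[/row_cellsP|/col_cellsP] [t t_lt ->]]; apply/mem_diagram.
- by exists 1, 1.
- by exists 0, t; rewrite GRing.addr0.
exists t, 0; rewrite GRing.addr0 /= size_nseq; split=> //; first by lia.
by case: t t_lt => [|[|t]] t_lt //=; [lia|rewrite nth_nseq ifT //; lia].
Qed.

Section NearHooks.
Variable n : nat.
Variables (k : nat) (Dl : seq cell) (X : finType) (pos : X -> 'I_n.+1 -> cell).
Hypothesis pos_D : enumerates pos (mem Dl).

(** The membership of the entry plus or minus one in the entries of [C], without
    reduction modulo the number of letters. *)
Definition next_in (C : seq cell) (f : 'I_n.+1 -> cell) (i : 'I_n.+1) : bool :=
  (i != ord_max) && (f (ordS i) \in C).
Definition prev_in (C : seq cell) (f : 'I_n.+1 -> cell) (i : 'I_n.+1) : bool :=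
  (i != ord0) && (f (ord_pred i) \in C).

Lemma minus_corner_criterion C : hook_minus_corner n.+1 k Dl C ->
  cyclic_family k (fun x => descents (pos x)) /\
  forall x, (#|descents (pos x)| == k.-1) = (pos x ord0 \in C).
Proof.
case=> k_bounds [p [q [C_eq [D_eq sep]]]].
have k_gt0 : 0 < k by lia.
have m_gt0 : 0 < n.+1 - k by lia.
have [q_above q_right] : (q.1 < p.1)%R /\ (p.2 < q.2)%R.
  apply: sep; rewrite ?C_eq ?mem_column ?mem_row -topredE /= /col_cells /row_cells.
    by lia.
  by lia.
have size_D : k + (n.+1 - k) = n.+1 by lia.
have D_cells : mem Dl =1 (fun c => col_cells p k c || row_cells q (n.+1 - k) c).
  by move=> c; rewrite [LHS]D_eq mem_cat C_eq mem_column mem_row.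
have [family max_in] :=
  minus_corner_shape k_gt0 m_gt0 size_D q_above q_right D_cells pos_D.
by split=> // x; rewrite max_in inE C_eq mem_column.
Qed.

Hypothesis n_gt0 : 0 < n.

Lemma NE_cell_criterion C c0 (mark : X -> 'I_n.+1) :
  hook_plus_NE_cell n.+1 k Dl C c0 -> (forall x, pos x (mark x) = c0) ->
  cyclic_family k (fun x => descents (pos x)) /\
  forall x, (#|descents (pos x)| == k.-1)
            = (mark x == ord_max) || next_in C (pos x) (mark x).
Proof.
case=> k_bounds [p [C_eq [D_eq sep]]] pos_mark.
have k_gt0 : 0 < k by lia.
have a_gt0 : 0 < n.+1 - k by lia.
have c0_NE c : hook_cells p (n.+1 - k) k c -> (c0.1 < c.1)%R /\ (c.2 < c0.2)%R.
  by move=> c_hook; apply: sep; rewrite ?mem_head // mem_hook.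
have [c0_above _] : (c0.1 < p.1)%R /\ (p.2 < c0.2)%R.
  by apply: c0_NE; rewrite /hook_cells /row_cells; lia.
have [_ c0_right] : (c0.1 < p.1)%R /\ (p.2 + (n - k)%:Z < c0.2)%R.
  by apply: (c0_NE (p.1, (p.2 + (n - k)%:Z)%R)); rewrite /hook_cells /row_cells /=; lia.
have c0_far : (p.2 + (n.+1 - k)%:Z <= c0.2)%R by lia.
have c0_out : ~~ hook_cells p (n.+1 - k) k c0.
  by rewrite /hook_cells /row_cells /col_cells; lia.
have size_D : n.+1 - k + k = n.+1 by lia.
have D_cells : mem Dl =1 (fun c => hook_cells p (n.+1 - k) k c || (c == c0)).
  by move=> c; rewrite [LHS]D_eq mem_cat mem_hook // mem_seq1.
have [family max_in] :=
  NE_cell_shape n_gt0 k_gt0 a_gt0 size_D D_cells c0_out pos_D pos_mark c0_above c0_far.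
split=> // x; rewrite max_in inE /next_in C_eq mem_hook_column.
by case: (mark x == ord_max).
Qed.

Lemma SW_cell_criterion C c0 (mark : X -> 'I_n.+1) :
  hook_plus_SW_cell n.+1 k Dl C c0 -> (forall x, pos x (mark x) = c0) ->
  cyclic_family k (fun x => descents (pos x)) /\
  forall x, (#|descents (pos x)| == k.-1)
            = (mark x == ord0) || next_in C (pos x) (mark x).
Proof.
case=> k_bounds [p [C_eq [D_eq sep]]] pos_mark.
have k_gt0 : 0 < k by lia.
have a_gt0 : 0 < n.+1 - k by lia.
have c0_SW c : hook_cells p (n.+1 - k) k c -> (c.1 < c0.1)%R /\ (c0.2 < c.2)%R.
  by move=> c_hook; apply: sep; rewrite ?mem_head // mem_hook.
have [_ c0_left] : (p.1 < c0.1)%R /\ (c0.2 < p.2)%R.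
  by apply: c0_SW; rewrite /hook_cells /row_cells; lia.
have [c0_below _] : (p.1 + k.-1%:Z < c0.1)%R /\ (c0.2 < p.2)%R.
  by apply: (c0_SW ((p.1 + k.-1%:Z)%R, p.2)); rewrite /hook_cells /col_cells /=; lia.
have c0_far : (p.1 + k%:Z <= c0.1)%R by lia.
have size_D : n.+1 - k + k = n.+1 by lia.
have D_cells : mem Dl =1 (fun c => hook_cells p (n.+1 - k) k c || (c == c0)).
  by move=> c; rewrite [LHS]D_eq mem_cat mem_hook // mem_seq1 orbC.
have [family max_in] :=
  SW_cell_shape n_gt0 k_gt0 a_gt0 size_D D_cells c0_left c0_far pos_D pos_mark.
by split=> // x; rewrite max_in inE /next_in C_eq mem_hook_column.
Qed.

Lemma internal_cell_criterion C c0 (mark : X -> 'I_n.+1) :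
  hook_plus_internal_cell n.+1 k Dl C c0 -> (forall x, pos x (mark x) = c0) ->
  cyclic_family k (fun x => descents (pos x)) /\
  forall x, (#|descents (pos x)| == k.-1) = prev_in C (pos x) (mark x).
Proof.
case=> k_bounds [p [C_eq c0_shift D_eq]] pos_mark.
have c0_eq : c0 = ((p.1 + 1)%R, (p.2 + 1)%R) := c0_shift.
have k_gt1 : 1 < k by lia.
have a_gt1 : 1 < n.+1 - k by lia.
have c0_out : ~~ hook_cells p (n.+1 - k) k c0.
  by rewrite c0_eq /hook_cells /row_cells /col_cells /=; lia.
have size_D : n.+1 - k + k = n.+1 by lia.
have D_cells : mem Dl =1 (fun c => hook_cells p (n.+1 - k) k c || (c == c0)).
  by move=> c; rewrite [LHS]D_eq mem_internal // c0_eq [LHS]inE orbC.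
have [family max_in] := internal_cell_shape n_gt0 (ltnW k_gt1) (ltnW a_gt1)
  size_D D_cells c0_out pos_D pos_mark c0_eq a_gt1 k_gt1.
by split=> // x; rewrite max_in inE /prev_in C_eq mem_hook_column.
Qed.

Lemma near_hook_family : near_hook n.+1 k Dl ->
  [/\ 0 < k, k <= n & cyclic_family k (fun x => descents (pos x))].
Proof.
have marked c0 : c0 \in Dl ->
    exists mark : X -> 'I_n.+1, forall x, pos x (mark x) = c0.
  move=> c0D; exists (fun x => odflt ord0 [pick i | pos x i == c0]) => x.
  have [/(_ x)[_ Dpos _] _ _] := pos_D; have [i posi] := (Dpos c0).1 c0D.
  by case: pickP => [j /eqP //|/(_ i)]; rewrite posi eqxx.
case=> [[C shape]|[C [c0 [] shape]]|[C [c0 shape]]].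
- have [family _] := minus_corner_criterion shape.
  by case: shape => k_bounds _; split=> //; lia.
- have [|mark pos_mark] := marked c0.
    by case: shape => _ [p [_ [-> _]]]; rewrite mem_cat mem_head orbT.
  have [family _] := NE_cell_criterion shape pos_mark.
  by case: shape => k_bounds _; split=> //; lia.
- have [|mark pos_mark] := marked c0.
    by case: shape => _ [p [_ [-> _]]]; rewrite mem_cat mem_head.
  have [family _] := SW_cell_criterion shape pos_mark.
  by case: shape => k_bounds _; split=> //; lia.
have [|mark pos_mark] := marked c0.
  case: shape => k_bounds [p [_ -> ->]]; rewrite mem_internal; try by lia.
  by rewrite inE eqxx.
have [family _] := internal_cell_criterion shape pos_mark.
by case: shape => k_bounds _; split=> //; lia.
Qed.

End NearHooks.

(** * Standard Young tableaux *)

Lemma map_rot180_seq (s : seq cell) : mem (map rot180 s) =1 mem s \o rot180.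
Proof. by move=> c; rewrite -[LHS](mem_map (inv_inj rot180K)) (mapK rot180K). Qed.

Section Tableaux.
Variables (n : nat) (lam mu : seq nat).
Local Notation shape := (skew_cells lam mu).
Local Notation tableau := (SYT n.+1 lam mu).
Implicit Types (T : tableau) (i : 'I_n.+1) (C : seq cell).

Lemma SYT_axioms T : [/\ injective T, forall i, exists c, T c = i
  & forall c d, precedes (val c) (val d) -> T c < T d].
Proof.
have /and3P[] : is_syt T := valP T.
move=> /injectiveP T_inj /forallP T_onto /'forall_forallP T_std.
split=> // [i|c d]; first by have /codomP[c ->] := T_onto i; exists c.
have /andP[/implyP row_std /implyP col_std] := T_std c d.
by case/orP; [apply: row_std|apply: col_std].
Qed.

Lemma SYT_onto T i : exists c, T c == i.
Proof. by have [_ /(_ i)[c <-] _] := SYT_axioms T; exists c. Qed.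

Definition SYT_cell T i : shape_cell_of lam mu := xchoose (SYT_onto T i).
Definition SYT_pos T i : cell := val (SYT_cell T i).

Lemma SYT_cellK T i : T (SYT_cell T i) = i.
Proof. exact/eqP/(xchooseP (SYT_onto T i)). Qed.

Lemma SYT_posP T i c : SYT_pos T i = val c <-> T c = i.
Proof.
have [T_inj _ _] := SYT_axioms T; split=> [/val_inj <-|Tc]; first exact: SYT_cellK.
by congr val; apply: T_inj; rewrite SYT_cellK.
Qed.

Lemma SYT_pos_enumerates : enumerates SYT_pos (mem shape).
Proof.
split=> [T|T T' eq_pos|f f_placed].
- have [T_inj T_onto T_std] := SYT_axioms T; split=> [i j|c|i j].
  + by move=> /val_inj eq_c; rewrite -(SYT_cellK T i) eq_c SYT_cellK.
  + split=> [c_in|[i <-]]; last exact: valP.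
    by exists (T (SeqSub c_in)); apply/(SYT_posP _ _ (SeqSub c_in)).
  by move=> /T_std; rewrite !SYT_cellK.
- apply/val_inj/ffunP => c; apply/esym/SYT_posP; rewrite -eq_pos.
  exact/SYT_posP.
have [f_inj Df f_std] := f_placed.
have f_onto (c : shape_cell_of lam mu) : exists i, f i == val c.
  by have [i <-] := (Df (val c)).1 (valP c); exists i.
pose T := [ffun c => xchoose (f_onto c)].
have fT c : f (T c) = val c by rewrite ffunE; apply/eqP/(xchooseP (f_onto c)).
have T_syt : is_syt T.
  apply/and3P; split.
  - by apply/injectiveP => c d eq_T; apply: val_inj; rewrite -!fT eq_T.
  - apply/forallP => i; apply/codomP; exists (SeqSub (placement_in i f_placed)).
    by apply: f_inj; rewrite fT.
  apply/'forall_forallP => c d; rewrite -!fT.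
  apply/andP; split; apply/implyP => prec; apply: f_std;
    by rewrite /precedes prec ?orbT.
exists (MkSYT T_syt) => i.
pose c : shape_cell_of lam mu := SeqSub (placement_in i f_placed).
by apply/(SYT_posP _ _ c); apply: f_inj; rewrite /= fT.
Qed.

Lemma descents_SYT T : descents (SYT_pos T) = Des T.
Proof.
apply/setP=> i; rewrite !inE; apply/andP/'exists_existsP.
  case=> i_neq row_lt; exists (SYT_cell T i), (SYT_cell T (ordS i)).
  by rewrite !SYT_cellK [val (ordS i)]val_ordS // !eqxx.
case=> c [d /and3P[/eqP Tc /eqP Td row_lt]].
have i_neq : i != ord_max.
  by rewrite -val_eqE /=; have := ltn_ord (T d); move: Td => /= ->; lia.
have Td' : T d = ordS i by apply: ord_inj; rewrite val_ordS.
by split; rewrite // (SYT_posP T i c).2 // (SYT_posP T (ordS i) d).2.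
Qed.

Lemma mem_entries T C i : (i.+1 \in entries T C) = (SYT_pos T i \in C).
Proof.
apply/mapP/idP => [[c]|posC].
  rewrite mem_filter => /andP[cC _] [] /ord_inj eq_i.
  by rewrite (SYT_posP T i c).2.
exists (SYT_cell T i); last by rewrite /entry SYT_cellK.
by rewrite mem_filter mem_enum andbT.
Qed.

Lemma entriesP T C m :
  reflect (exists2 i : 'I_n.+1, m = i.+1 & SYT_pos T i \in C) (m \in entries T C).
Proof.
apply: (iffP idP) => [|[i -> posC]]; last by rewrite mem_entries.
move=> m_in; have /mapP[c _ m_eq] := m_in; exists (T c) => //.
by rewrite -mem_entries -[(T c).+1]m_eq.
Qed.

Lemma mem_pred_entries T C i :
  (i.+1 \in map predn (entries T C)) = next_in C (SYT_pos T) i.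
Proof.
apply/mapP/andP => [[m /entriesP[j -> posC] /= eq_ij]|[i_neq posC]].
  have i_neq : i != ord_max by rewrite -val_eqE /=; have := ltn_ord j; lia.
  by split=> //; have -> : ordS i = j by apply: ord_inj; rewrite val_ordS.
by exists (ordS i).+1; rewrite ?mem_entries // val_ordS.
Qed.

Lemma mem_succ_entries T C i :
  (i.+1 \in map succn (entries T C)) = prev_in C (SYT_pos T) i.
Proof.
apply/mapP/andP => [[m /entriesP[j -> posC] [eq_ij]]|[i_neq posC]].
  have i_neq : i != ord0 by rewrite -val_eqE /= eq_ij.
  split=> //; have -> // : ord_pred i = j.
  by apply: ord_inj; rewrite val_ord_pred // eq_ij.
exists (ord_pred i).+1; first by rewrite mem_entries.
by rewrite val_ord_pred // prednK // lt0n.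
Qed.

(** Rotation exchanges successor and predecessor, which is why [C - 1] and [C + 1]
    change places in the criteria for reversed shapes. *)
Lemma next_in_rotate C (f : 'I_n.+1 -> cell) i :
  next_in (map rot180 C) (rotate_placement f) (rev_ord i) = prev_in C f i.
Proof.
have rev0 : ord_max = rev_ord ord0 :> 'I_n.+1 by rewrite -rev_ord_max rev_ordK.
rewrite /next_in /prev_in /rotate_placement rev_ordS rev_ordK rev0.
by rewrite (mem_map (inv_inj rot180K)) (inj_eq rev_ord_inj).
Qed.

Lemma prev_in_rotate C (f : 'I_n.+1 -> cell) i :
  prev_in (map rot180 C) (rotate_placement f) (rev_ord i) = next_in C f i.
Proof.
rewrite /next_in /prev_in /rotate_placement -rev_ordS rev_ordK -rev_ord_max.
by rewrite (mem_map (inv_inj rot180K)) (inj_eq rev_ord_inj).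
Qed.

Lemma rotated_enumerates :
  enumerates (fun T => rotate_placement (SYT_pos T)) (mem (map rot180 shape)).
Proof.
apply: eq_enumerates (enumerates_rotate SYT_pos_enumerates) => c.
by rewrite map_rot180_seq.
Qed.

Lemma descents_rotated T :
  descents (rotate_placement (SYT_pos T)) = @flip n @^-1: Des T.
Proof. by rewrite descents_rotate descents_SYT. Qed.

Lemma card_descents_rotated T :
  #|descents (rotate_placement (SYT_pos T))| = #|Des T|.
Proof.
by rewrite descents_rotated on_card_preimset //; apply/onW_bij/inv_bij/flipK.
Qed.

Lemma SYT_pos_cell T c : SYT_pos T (T c) = val c.
Proof. exact/SYT_posP. Qed.

Lemma rotated_pos_cell T c :
  rotate_placement (SYT_pos T) (rev_ord (T c)) = rot180 (val c).
Proof. by rewrite /rotate_placement rev_ordK SYT_pos_cell. Qed.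

Lemma perm_shift_invariant (F : tableau -> {set 'I_n.+1}) :
  perm_eq [seq [set ordS i | i in F T] | T : tableau] [seq F T | T : tableau]
  <-> shift_invariant F.
Proof.
have count_F (G : tableau -> {set 'I_n.+1}) S :
    count_mem S [seq G T | T : tableau] = #|[set T | G T == S]|.
  rewrite count_map cardsE cardE /enum_mem size_filter count_filter.
  by apply: eq_count => T; rewrite /= andbT.
split=> [/permP eqF S|invF].
  have := eqF (pred1 (cshift S)); rewrite !count_F => <-.
  by congr #|pred_of_set _|; apply/setP=> T; rewrite !inE (inj_eq (@cshift_inj n)).
apply/allP => S _; apply/eqP; rewrite /= !count_F -(cunshiftK S) invF.
by congr #|pred_of_set _|; apply/setP=> T; rewrite !inE (inj_eq (@cshift_inj n)).
Qed.

Lemma max_letter (A : {set 'I_n.+1}) : n.+1 \in letters A <-> ord_max \in A.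
Proof.
split=> [/imageP[i iA [n_eq]]|A_max]; last by apply/imageP; exists ord_max.
by have -> : ord_max = i by apply: ord_inj.
Qed.

Section Criteria.
Variables (k : nat) (T : tableau).
Hypothesis n_gt0 : 0 < n.

(** For a reversed shape the criterion of the near-hook is applied to the rotated
    placement, whose descent set has the same size. *)
Lemma SYT_criteria : explicit_criteria k (fun U => cyc_close k (Des U)) T.
Proof.
have Des'max : ord_max \notin Des T by rewrite -descents_SYT max_in_descents.
have pos_enum := SYT_pos_enumerates; have rot_enum := rotated_enumerates.
have DesE := descents_SYT T; have rot_card := card_descents_rotated T.
have neg_max : (rev_ord (ord_max : 'I_n.+1)) = ord0 := rev_ord_max n.
have eq0 i : (i.+1 == 1) = (i == ord0) by [].
have eq_max i : (i.+1 == n.+1) = (i == ord_max) by [].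
have rev_eq0 i : (rev_ord i == ord0) = (i == ord_max).
  by rewrite -neg_max (inj_eq rev_ord_inj).
have rev_eq_max i : (rev_ord i == ord_max) = (i == ord0).
  by rewrite -rev_eq0 rev_ordK.
have crit b b' : (#|Des T| == k.-1) = b -> b' = b ->
    (n.+1 \in letters (cyc_close k (Des T))) <-> b'.
  move=> <- ->; apply: (iff_trans (max_letter _)).
  by rewrite max_in_cyc_close.
split; split=> C.
- move=> /(minus_corner_criterion pos_enum)[_ /(_ T)]; rewrite DesE => /crit; apply.
  exact: (mem_entries T C ord0).
- move=> /(minus_corner_criterion rot_enum)[_ /(_ T)]; rewrite rot_card => /crit; apply.
  rewrite (mem_entries T C ord_max) /rotate_placement -neg_max rev_ordK.
  by rewrite (mem_map (inv_inj rot180K)).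
- move=> c0 /(NE_cell_criterion pos_enum n_gt0)/(_ (SYT_pos_cell^~ c0))[_ /(_ T)].
  rewrite DesE => /crit; apply.
  by rewrite mem_pred_entries eq_max orbC.
- move=> c0 /(NE_cell_criterion rot_enum n_gt0)/(_ (rotated_pos_cell^~ c0))[_ /(_ T)].
  rewrite rot_card next_in_rotate rev_eq_max => /crit; apply.
  by rewrite mem_succ_entries eq0 orbC.
- move=> c0 /(SW_cell_criterion pos_enum n_gt0)/(_ (SYT_pos_cell^~ c0))[_ /(_ T)].
  rewrite DesE => /crit; apply.
  by rewrite mem_pred_entries eq0 orbC.
- move=> c0 /(SW_cell_criterion rot_enum n_gt0)/(_ (rotated_pos_cell^~ c0))[_ /(_ T)].
  rewrite rot_card next_in_rotate rev_eq0 => /crit; apply.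
  by rewrite mem_succ_entries eq_max orbC.
- move=> c0 /(internal_cell_criterion pos_enum n_gt0)/(_ (SYT_pos_cell^~ c0))[_ /(_ T)].
  rewrite DesE => /crit; apply.
  exact: mem_succ_entries.
move=> c0 /(internal_cell_criterion rot_enum n_gt0)/(_ (rotated_pos_cell^~ c0))[_ /(_ T)].
rewrite rot_card prev_in_rotate => /crit; apply.
exact: mem_pred_entries.
Qed.

End Criteria.

Lemma SYT_family k : 0 < n ->
  near_hook n.+1 k shape \/ near_hook n.+1 k (map rot180 shape) ->
  [/\ 0 < k, k <= n & cyclic_family k (@Des n.+1 lam mu)].
Proof.
move=> n_gt0 [] shape_near.
  have [k_gt0 k_le family] := near_hook_family SYT_pos_enumerates n_gt0 shape_near.
  by split=> //; apply: eq_cyclic_family descents_SYT family.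
have [k_gt0 k_le family] := near_hook_family rotated_enumerates n_gt0 shape_near.
split=> //; apply: eq_cyclic_family (cyclic_family_flip family) => T.
by rewrite descents_rotated; apply/setP=> i; rewrite !inE flipK.
Qed.

End Tableaux.

Theorem corollary3p9 (n k : nat) (lam mu : seq nat)
    (n_ge2 : 2 <= n)
    (skew_lam_mu : is_skew_shape lam mu)
    (size_lam_mu : size (skew_cells lam mu) = n)
    (near_hook_lam_mu : near_hook n k (skew_cells lam mu) \/
                        near_hook n k (map rot180 (skew_cells lam mu))) :
  exists cDes : SYT n lam mu -> {set 'I_n},
    [/\ is_cyclic_descent_map cDes,
        (forall cDes' : SYT n lam mu -> {set 'I_n},
           is_cyclic_descent_map cDes' ->
           (n = 2 -> forall T, cDes' T != set0 /\ cDes' T != [set: 'I_n]) ->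
           forall T, cDes' T = cDes T),
        (forall T, n \in letters (cDes T) <-> #|Des T| = k - 1),
        (forall T, #|cDes T| = k)
      & (forall T, explicit_criteria k cDes T)].
Proof.
case: n n_ge2 {size_lam_mu} near_hook_lam_mu => // n n_gt0 near_lam_mu.
have [k_gt0 k_le family] := SYT_family n_gt0 near_lam_mu.
have [Des'max card_cyc cyc_inv] := family.
have below_max (A : {set 'I_n.+1}) :
    A :&: [set i : 'I_n.+1 | i.+1 < n.+1] = A :\ ord_max.
  apply/setP=> i; rewrite !inE andbC ltnS -val_eqE /=; congr (_ && _).
  by have := ltn_ord i; lia.
exists (fun T => cyc_close k (Des T)).
split=> // [|cDes' [cDes'_Des cDes'_inv] nontriv|T|T].
- split; last exact/perm_shift_invariant.
  by move=> T; rewrite below_max cyc_closeD1.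
- apply: (cyclic_family_unique k_gt0 k_le family) => [T||n1 T].
  + by rewrite -below_max.
  + exact/perm_shift_invariant.
  by apply: nontriv; rewrite n1.
- apply: (iff_trans (max_letter _)); rewrite max_in_cyc_close // subn1.
  by split=> /eqP.
exact: SYT_criteria.
Qed.
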